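(* Let $G$ be a non-trivial generalised Baumslag--Solitar group. If $G$ is not $C^*$-simple then either $G$ is isomorphic to a solvable Baumslag--Solitar group $BS(1,n)=\langle a,t\mid tat^{-1}=a^n\rangle$, for some $n\in\mathbb{Z}\setminus\{0\}$, or $G$ is unimodular.
   Context: A group is $C^*$-simple if its reduced $C^*$-algebra is simple (has no non-trivial proper closed two-sided ideals). A non-trivial group is a generalised Baumslag--Solitar group if it splits as the fundamental group of a finite graph of groups in which all vertex and edge groups are infinite cyclic. A generalised Baumslag--Solitar group $G$ is unimodular if for any $x,y\in G\setminus\{1\}$ and any $m,n\in\mathbb{Z}$, the equation $xy^mx^{-1}=y^n$ implies $|m|=|n|$. *)

(* Defs.v *)
From HB Require Import structures.
From mathcomp Require Import all_boot all_order all_algebra.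
From mathcomp Require Import all_classical all_reals.
From mathcomp Require Import ereal esum.
From mathcomp.real_closed Require Import complex.
From mathcomp Require Import ring.

Set Implicit Arguments.
Unset Strict Implicit.
Unset Printing Implicit Defensive.

Import Order.TTheory GRing.Theory Num.Theory.
Import ComplexField.Normc.

Local Open Scope classical_set_scope.
Local Open Scope ring_scope.

Definition nontrivial (G : groupType) : Prop := exists x : G, x != 1%g.

Definition expgz (G : groupType) (x : G) (k : int) : G :=
  match k with
  | Posz n => (x ^+ n)%g
  | Negz n => (x ^- n.+1)%g
  end.

Definition isomorphic (G H : groupType) : Prop :=
  exists f : {multiplicative G -> H}, bijective f.

Definition infinite_cyclic (G : groupType) : Prop :=
  exists x : G, bijective (expgz x).

(** A letter [(x, false)] stands for the generator [x] and [(x, true)] for its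
    formal inverse; a relation [rel u v] is the equation [u = v]. *)

Definition word (X : Type) : Type := seq (X * bool).

Definition gen (X : Type) (x : X) : word X := [:: (x, false)].
Definition geninv (X : Type) (x : X) : word X := [:: (x, true)].
Definition genexp (X : Type) (x : X) (k : int) : word X :=
  match k with
  | Posz n => nseq n (x, false)
  | Negz n => nseq n.+1 (x, true)
  end.

Definition winv (X : Type) (w : word X) : word X :=
  rev [seq (l.1, ~~ l.2) | l <- w].

Inductive word_eq (X : Type) (rel : word X -> word X -> Prop) :
    word X -> word X -> Prop :=
| word_eq_refl u : word_eq rel u u
| word_eq_sym u v : word_eq rel u v -> word_eq rel v u
| word_eq_trans u v w : word_eq rel u v -> word_eq rel v w -> word_eq rel u w
| word_eq_cat u u' v v' :
    word_eq rel u u' -> word_eq rel v v' -> word_eq rel (u ++ v) (u' ++ v')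
| word_eq_cancel x b : word_eq rel [:: (x, b); (x, ~~ b)] [::]
| word_eq_rel u v : rel u v -> word_eq rel u v.

Section PresentedGroup.
Variables (X : choiceType) (rel : word X -> word X -> Prop).

Definition word_eqb (u v : seq (X * bool)) : bool := `[< word_eq rel u v >].

Lemma word_eqb_refl : reflexive word_eqb.
Proof. by move=> u; apply/asboolP; exact: word_eq_refl. Qed.

Lemma word_eqb_sym : symmetric word_eqb.
Proof. by move=> u v; apply/asboolP/asboolP; exact: word_eq_sym. Qed.

Lemma word_eqb_trans : transitive word_eqb.
Proof.
move=> v u w /asboolP uv /asboolP vw; apply/asboolP.
exact: word_eq_trans uv vw.
Qed.

Canonical word_equiv :=
  EquivRel word_eqb word_eqb_refl word_eqb_sym word_eqb_trans.

Local Open Scope quotient_scope.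

Definition presented : Type := {eq_quot word_equiv}.

HB.instance Definition _ := Choice.on presented.

Definition pclass (w : word X) : presented := \pi_{eq_quot word_equiv} w.
Definition pword (a : presented) : word X := repr (a : {eq_quot word_equiv}).

Lemma pwordK a : pclass (pword a) = a.
Proof. exact: reprK. Qed.

Lemma pclassP u v : pclass u = pclass v <-> word_eq rel u v.
Proof. by split=> [/eqmodP/asboolP|uv] //; apply/eqmodP/asboolP. Qed.

Lemma pword_pclass u : word_eq rel (pword (pclass u)) u.
Proof. by apply/pclassP; rewrite pwordK. Qed.

Lemma word_eq_mulV w : word_eq rel (winv w ++ w) [::].
Proof.
elim: w => [|[x b] w IHw]; first exact: word_eq_refl.
rewrite /winv /= rev_cons -cats1 -catA /=.
have -> : (x, ~~ b) :: (x, b) :: w = [:: (x, ~~ b); (x, ~~ ~~ b)] ++ w.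
  by rewrite negbK.
apply: word_eq_trans IHw; apply: word_eq_cat; first exact: word_eq_refl.
by rewrite -[X in word_eq _ _ X]cat0s;
   apply: word_eq_cat; [exact: word_eq_cancel|exact: word_eq_refl].
Qed.

Lemma winvK : involutive (@winv X).
Proof.
move=> w; rewrite /winv map_rev revK -map_comp -[RHS]map_id.
by apply: eq_map => -[x b] /=; rewrite negbK.
Qed.

Lemma word_eq_mulVr w : word_eq rel (w ++ winv w) [::].
Proof. by rewrite -{1}[w]winvK; exact: word_eq_mulV. Qed.

Lemma word_eq_winv u v : word_eq rel u v -> word_eq rel (winv u) (winv v).
Proof.
move=> uv; rewrite -[winv u]cats0.
apply: (@word_eq_trans _ _ _ (winv u ++ (u ++ winv v))).
  apply: word_eq_cat; first exact: word_eq_refl.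
  apply/word_eq_sym; apply: word_eq_trans (word_eq_mulVr v).
  by apply: word_eq_cat => //; exact: word_eq_refl.
rewrite catA -[X in word_eq _ _ X]cat0s; apply: word_eq_cat.
  exact: word_eq_mulV.
exact: word_eq_refl.
Qed.

Definition pmul (a b : presented) : presented := pclass (pword a ++ pword b).
Definition pone : presented := pclass [::].
Definition pinv (a : presented) : presented := pclass (winv (pword a)).

Lemma pclassM u v : pclass (u ++ v) = pmul (pclass u) (pclass v).
Proof.
by apply/pclassP/word_eq_sym; apply: word_eq_cat; exact: pword_pclass.
Qed.

Lemma pmulA : associative pmul.
Proof.
move=> a b c; rewrite -[a]pwordK -[b]pwordK -[c]pwordK -!pclassM.
by rewrite catA.
Qed.

Lemma pmul1 : left_id pone pmul.
Proof. by move=> a; rewrite -[a]pwordK -pclassM. Qed.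

Lemma pmulr1 : right_id pone pmul.
Proof. by move=> a; rewrite -[a]pwordK -pclassM cats0. Qed.

Lemma pmulV : left_inverse pone pinv pmul.
Proof.
move=> a; rewrite -[X in pmul _ X]pwordK -pclassM.
by apply/pclassP; exact: word_eq_mulV.
Qed.

Lemma pmulVr : right_inverse pone pinv pmul.
Proof.
move=> a; rewrite -[X in pmul X _]pwordK -pclassM.
by apply/pclassP; exact: word_eq_mulVr.
Qed.

HB.instance Definition _ :=
  isGroup.Build presented pmulA pmul1 pmulr1 pmulV pmulVr.

End PresentedGroup.

Definition BS_a : bool := false.
Definition BS_t : bool := true.

Inductive BS1_rel (n : int) : word bool -> word bool -> Prop :=
| BS1_rel_conj :
    BS1_rel n (gen BS_t ++ gen BS_a ++ geninv BS_t) (genexp BS_a n).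

Definition BS1 (n : int) : groupType := presented (BS1_rel n).

(** The underlying finite graph is given by its geometric edges with a chosen
    orientation [gorig], [gterm]; loops and multiple edges are allowed.  The
    edges of the corresponding graph in the sense of Serre are the pairs [(e, b)], where
    [b = true] means that [e] is traversed backwards. *)

Record graph_of_groups := GraphOfGroups {
  vert : finType;
  edge : finType;
  gorig : edge -> vert;
  gterm : edge -> vert;
  vgroup : vert -> groupType;
  egroup : edge -> groupType;
  oincl : forall e, {multiplicative egroup e -> vgroup (gorig e)};
  tincl : forall e, {multiplicative egroup e -> vgroup (gterm e)};
  oincl_inj : forall e, injective (oincl e);
  tincl_inj : forall e, injective (tincl e)
}.

Section FundamentalGroup.
Variable Y : graph_of_groups.

Definition oedge : Type := (edge Y * bool)%type.
Definition osrc (d : oedge) : vert Y := if d.2 then gterm d.1 else gorig d.1.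
Definition otgt (d : oedge) : vert Y := if d.2 then gorig d.1 else gterm d.1.
Definition obar (d : oedge) : oedge := (d.1, ~~ d.2).

(* Serre's circuits, which include loops ([n = 1]) and pairs of parallel edges
   ([n = 2]). *)
Definition is_circuit (s : seq oedge) : bool :=
  [&& s != [::],
      cycle (fun d d' : oedge => (otgt d == osrc d') && (d' != obar d)) s
    & uniq [seq otgt d | d <- s]].

Definition connected_by (T : {set edge Y}) : Prop :=
  forall u v : vert Y,
    connect (fun x y => [exists d : edge Y * bool,
      [&& d.1 \in T, osrc d == x & otgt d == y]]) u v.

Definition acyclic (T : {set edge Y}) : Prop :=
  forall s : seq oedge, all (fun d => d.1 \in T) s -> ~~ is_circuit s.

(* Having a spanning tree forces the graph to be non-empty and connected. *)
Definition spanning_tree (T : {set edge Y}) : Prop :=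
  [/\ (0 < #|vert Y|)%N, connected_by T & acyclic T].

Definition pi1_gen : Type := ({v : vert Y & vgroup v} + edge Y)%type.

HB.instance Definition _ := Choice.on pi1_gen.

Definition vgen (v : vert Y) (g : vgroup v) : pi1_gen :=
  inl (Tagged (fun v => vgroup v : Type) g).
Definition egen (e : edge Y) : pi1_gen := inr e.

Inductive pi1_rel (T : {set edge Y}) : word pi1_gen -> word pi1_gen -> Prop :=
| pi1_rel_vertex v (g h : vgroup v) :
    pi1_rel T (gen (vgen g) ++ gen (vgen h)) (gen (vgen (g * h)%g))
| pi1_rel_edge e (c : egroup e) :
    pi1_rel T (gen (egen e) ++ gen (vgen (tincl e c)) ++ geninv (egen e))
              (gen (vgen (oincl e c)))
| pi1_rel_tree e : e \in T -> pi1_rel T (gen (egen e)) [::].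

(* Up to isomorphism this does not depend on the spanning tree [T]. *)
Definition pi1 (T : {set edge Y}) : groupType := presented (pi1_rel T).

End FundamentalGroup.

Definition generalised_BS (G : groupType) : Prop :=
  nontrivial G /\
  exists (Y : graph_of_groups) (T : {set edge Y}),
    [/\ spanning_tree T,
        forall v : vert Y, infinite_cyclic (vgroup v),
        forall e : edge Y, infinite_cyclic (egroup e)
      & isomorphic G (pi1 T)].

Definition unimodular (G : groupType) : Prop :=
  forall x y : G, x != 1%g -> y != 1%g -> forall m n : int,
    (x * expgz y m * x^-1)%g = expgz y n -> `|m| = `|n|.

Section HilbertSpace.
Variables (R : realType) (G : groupType).
Implicit Types f g : G -> R[i].

Definition l2term f (x : G) : \bar R := ((normc (f x)) ^+ 2)%:E.

Definition l2_pred : {pred (G -> R[i])} :=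
  fun f => `[< summable [set: G] (l2term f) >].

Lemma l2term_ge0 f x : (0 <= l2term f x)%E.
Proof. by rewrite lee_fin sqr_ge0. Qed.

Lemma l2_predE f :
  (f \in l2_pred) = (\esum_(x in [set: G]) l2term f x < +oo)%E.
Proof.
rewrite unfold_in /summable (@eq_esum _ _ _ _ (l2term f)).
  by apply/asboolP/idP.
by move=> x _; rewrite gee0_abs// l2term_ge0.
Qed.

Lemma normc_sqr (z : R[i]) : normc z ^+ 2 = complex.Re z ^+ 2 + complex.Im z ^+ 2.
Proof. by case: z => a b /=; rewrite sqr_sqrtr// addr_ge0 ?sqr_ge0. Qed.

Lemma esumZ_lty (k : R) f : 0 <= k -> f \in l2_pred ->
  (\esum_(x in [set: G]) (k%:E * l2term f x) < +oo)%E.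
Proof.
move=> k0; rewrite l2_predE => f2.
have fin : (\esum_(x in [set: G]) l2term f x)%E \is a fin_num.
  by rewrite ge0_fin_numE// esum_ge0// => x _; exact: l2term_ge0.
apply: (@le_lt_trans _ _ (k%:E * \esum_(x in [set: G]) l2term f x)%E).
  apply: ge_ereal_sup => _ [A AG <-].
  rewrite -ge0_mule_fsumr; last by move=> x; exact: l2term_ge0.
  rewrite lee_wpmul2l ?lee_fin//.
  by apply: ereal_sup_ubound; exists A.
by rewrite -(fineK fin) -EFinM ltry.
Qed.

Lemma l2_submod_closed : submod_closed l2_pred.
Proof.
split=> [|c f g f2 g2]; rewrite l2_predE.
  rewrite esum1 ?ltry// => x _.
  by rewrite /l2term normc_sqr /= expr0n /= addr0.
set h := c *: f + g.
pose k : R := 2 * normc c ^+ 2.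
have k0 : 0 <= k by rewrite mulr_ge0 ?sqr_ge0.
have ptw x : (l2term h x <= k%:E * l2term f x + 2%:E * l2term g x)%E.
  rewrite /l2term -!EFinM -EFinD lee_fin /k -mulrA -exprMn -normcM.
  have -> : h x = c * f x + g x by [].
  rewrite !normc_sqr; case: (c * f x) (g x) => [a b] [a' b'] /=.
  rewrite -subr_ge0.
  have -> : 2 * (a ^+ 2 + b ^+ 2) + 2 * (a' ^+ 2 + b' ^+ 2) -
     ((a + a') ^+ 2 + (b + b') ^+ 2) = (a - a') ^+ 2 + (b - b') ^+ 2 by ring.
  by rewrite addr_ge0 ?sqr_ge0.
apply: le_lt_trans (le_esum _) _; first by move=> x _; exact: ptw.
rewrite esumD; first by rewrite lte_add_pinfty// esumZ_lty.
- by move=> x _; apply: mule_ge0; [rewrite lee_fin|exact: l2term_ge0].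
- by move=> x _; apply: mule_ge0; [rewrite lee_fin|exact: l2term_ge0].
Qed.

HB.instance Definition _ :=
  GRing.isSubmodClosed.Build R[i] (G -> R[i]) l2_pred
    (GRing.submod_closed_semi l2_submod_closed).

Record l2 : Type := L2 { l2fun :> G -> R[i]; _ : l2fun \in l2_pred }.

HB.instance Definition _ := [isSub for l2fun].
HB.instance Definition _ := [Choice of l2 by <:].
HB.instance Definition _ := [SubChoice_isSubLmodule of l2 by <:].

Definition l2norm (v : l2) : R :=
  Num.sqrt (fine (\esum_(x in [set: G]) l2term v x)).

Lemma translate_l2 (g : G) (v : l2) : (fun x => v (g^-1 * x)%g) \in l2_pred.
Proof.
case: v => f /= f2; rewrite l2_predE.
rewrite -(reindex_esum setT setT (fun x => (g^-1 * x)%g) (l2term f)).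
- by rewrite -l2_predE.
- split=> [x//|x y _ _ /mulgI//|y _]; exists (g * y)%g => //=.
  by rewrite mulKg.
Qed.

Definition lreg (g : G) (v : l2) : l2 := L2 (translate_l2 g v).

(* Operators are plain functions [l2 -> l2], a complex vector space for the
   pointwise operations; linearity and boundedness are imposed by
   [norm_closure]. *)
Definition bounded_op (T : l2 -> l2) : Prop :=
  linear T /\ exists M : R, forall v, l2norm (T v) <= M * l2norm v.

(* [sup] is 0 on sets without an upper bound, so this is only meaningful for
   bounded operators. *)
Definition opnorm (T : l2 -> l2) : R :=
  sup [set l2norm (T v) | v in [set v : l2 | l2norm v <= 1]].

Definition norm_closure (A : set (l2 -> l2)) : set (l2 -> l2) :=
  [set T | bounded_op T /\
    forall e : R, 0 < e -> exists S, [/\ A S, bounded_op S & opnorm (T - S) < e]].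

(* The span of the operators of the left regular representation. *)
Definition group_algebra_op : set (l2 -> l2) :=
  [set T | exists (s : seq G) (c : G -> R[i]),
    T = \sum_(g <- s) c g *: lreg g].

Definition reduced_Cstar : set (l2 -> l2) := norm_closure group_algebra_op.

Definition closed_ideal (A I : set (l2 -> l2)) : Prop :=
  [/\ I `<=` A, I 0,
      forall (c : R[i]) S T, I S -> I T -> I (c *: S + T),
      forall S T, A S -> I T -> I (S \o T) /\ I (T \o S)
    & norm_closure I `<=` I].

Definition simple_Cstar (A : set (l2 -> l2)) : Prop :=
  forall I, closed_ideal A I -> I = [set 0] \/ I = A.

Definition Cstar_simple : Prop := simple_Cstar reduced_Cstar.

End HilbertSpace.

(* Main.v *)
(** If [G] is neither unimodular nor a solvable Baumslag-Solitar group, we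
    verify a form of Powers' criterion for its action on a tree.

    Identifying all the vertices of the graph of groups embeds [G] in a multiple
    HNN extension [B] of the integers [<a>], which acts on its Bass-Serre tree
    with infinite cyclic stabilisers.  Normal forms give the Lyndon length
    function [L] (the displacement of a base vertex) and the Gromov product [c],
    the length of the longest common prefix, and all the geometry of the tree
    that is needed is expressed with [L] and [c].  The modulus [B -> Q^*],
    defined by [g a^i g^-1 = a^j -> modulus g = j / i], is read off an affine
    action of [B] on the line.

    As translation lengths are conjugacy invariants, non-unimodularity yields
    [t] in [G] of modulus greater than [1] in absolute value; it is hyperbolic.
    If [f] fixes pointwise a ray towards the attracting end of [t], then
    [t^-n f t^n] is for every [n] a power of [a] whose exponent is that of [f]
    divided by [modulus t ^ n], so [f = 1].  Hence a nontrivial element fixes at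
    most two ends in the orbit of that end, because an isometry fixing three
    ends has zero translation along each of them.  Half-trees around an end
    moved by a given finite set of elements are then disjoint from their
    translates.  If the repelling end of [t] is not fixed by [G], its orbit is
    infinite, and translates of [t ^ -M] by elements moving this end to distinct
    ends provide the disjoint conjugates required by Powers' averaging argument.

    If [G] fixes the repelling end, the stabiliser of a vertex on the axis is
    some [<b>], the elliptic elements form the increasing union of its conjugates
    by powers of [t], and [G] is generated by [b] and an element [u] of minimal
    translation length; the modulus of [u^-1] is an integer [n] since one of its
    powers is, and [G] is isomorphic to [BS(1, n)]. *)

Require Import Defs.
From HB Require Import structures.
From mathcomp Require Import all_boot all_order all_algebra.
From mathcomp Require Import all_classical all_reals.
From mathcomp Require Import ereal esum.
From mathcomp.real_closed Require Import complex.
From mathcomp Require Import ring lra zify.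

Set Implicit Arguments.
Unset Strict Implicit.
Unset Printing Implicit Defensive.

Import Order.TTheory GRing.Theory Num.Theory.
Import ComplexField.Normc.

Local Open Scope classical_set_scope.
Local Open Scope ring_scope.

(** * The Hilbert space of square-summable functions *)

Section L2Norm.
Variables (R : realType) (G : groupType).
Implicit Types (u v w : l2 R G).

Definition sqnorm v : R := fine (\esum_(x in [set: G]) l2term v x).

Lemma sqnormE v : \esum_(x in [set: G]) l2term v x = (sqnorm v)%:E.
Proof.
rewrite /sqnorm fineK// ge0_fin_numE; first by rewrite -l2_predE (valP v).
by apply: esum_ge0 => x _; exact: l2term_ge0.
Qed.

Lemma sqnorm_ge0 v : 0 <= sqnorm v.
Proof. by rewrite fine_ge0// esum_ge0// => x _; exact: l2term_ge0. Qed.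

Lemma normc_ge0 (z : R[i]) : 0 <= normc z.
Proof. by case: z => a b; exact: sqrtr_ge0. Qed.

Lemma l2norm_ge0 v : 0 <= l2norm v.
Proof. exact: sqrtr_ge0. Qed.

Lemma l2norm_sqr v : l2norm v ^+ 2 = sqnorm v.
Proof. by rewrite sqr_sqrtr// sqnorm_ge0. Qed.

Lemma le_l2norm v (M : R) : 0 <= M -> sqnorm v <= M ^+ 2 -> l2norm v <= M.
Proof. by move=> M0 h; rewrite -(ger0_norm M0) -sqrtr_sqr ler_wsqrtr. Qed.

Lemma esum_sum_sqnorm (I : Type) (r : seq I) (k : I -> R) (f : I -> l2 R G) :
  (forall i, 0 <= k i) ->
  \esum_(x in [set: G]) (\sum_(i <- r) k i * normc (f i x) ^+ 2)%:E =
  (\sum_(i <- r) k i * sqnorm (f i))%:E.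
Proof.
move=> k0.
have t0 i x : 0 <= k i * normc (f i x) ^+ 2 by rewrite mulr_ge0 ?sqr_ge0.
elim: r => [|i r IHr].
  by rewrite big_nil esum1// => x _; rewrite big_nil.
rewrite big_cons EFinD -IHr.
under eq_esum do rewrite big_cons EFinD.
rewrite esumD; [|by move=> x _; rewrite lee_fin|
  by move=> x _; rewrite lee_fin sumr_ge0].
congr (_ + _)%E; apply/eqP; rewrite eq_le EFinM -sqnormE; apply/andP; split.
  apply: ge_ereal_sup => _ [A AG <-].
  under eq_fsbigr do rewrite EFinM.
  rewrite -ge0_mule_fsumr; last by move=> x; rewrite lee_fin sqr_ge0.
  by rewrite lee_wpmul2l ?lee_fin//; apply: ereal_sup_ubound; exists A.
(* The reverse inequality divides by [k i], so the weight 0 is treated apart. *)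
have [->|ki] := eqVneq (k i) 0.
  by rewrite mul0e esum_ge0// => x _; rewrite lee_fin mul0r.
rewrite -lee_pdivlMl; last by rewrite lt0r ki k0.
apply: ge_ereal_sup => _ [A AG <-].
rewrite lee_pdivlMl; last by rewrite lt0r ki k0.
rewrite ge0_mule_fsumr; last by move=> x; exact: l2term_ge0.
by apply: esum_ge; exists A.
Qed.

(** Integrates pointwise inequalities over the group. The triangle inequality and the orthogonality
    estimates below follow from it, without an inner product. *)
Lemma le_sum_sqnorm (I J : Type) (r : seq I) (s : seq J)
    (k : I -> R) (f : I -> l2 R G) (m : J -> R) (g : J -> l2 R G) :
  (forall i, 0 <= k i) -> (forall j, 0 <= m j) ->
  (forall x, \sum_(i <- r) k i * normc (f i x) ^+ 2 <=
             \sum_(j <- s) m j * normc (g j x) ^+ 2) ->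
  \sum_(i <- r) k i * sqnorm (f i) <= \sum_(j <- s) m j * sqnorm (g j).
Proof.
move=> k0 m0 h; rewrite -lee_fin -!esum_sum_sqnorm//.
by apply: le_esum => x _; rewrite lee_fin.
Qed.

Lemma sqnorm_eq0 v : sqnorm v = 0 -> v = 0.
Proof.
move=> v0; apply: val_inj; apply/funext => x /=.
apply: (@eq0_normc R); apply/eqP; rewrite -sqrf_eq0 eq_le sqr_ge0 andbT.
rewrite -lee_fin -v0 -sqnormE; apply: esum_ge; exists [set x].
  by split=> //; exact: finite_set1.
by rewrite fsbig_set1.
Qed.

Lemma le_normc_l2norm v x : normc (v x) <= l2norm v.
Proof.
rewrite -(@ler_pXn2r _ 2)// ?nnegrE ?normc_ge0 ?l2norm_ge0//.
rewrite l2norm_sqr -lee_fin -sqnormE; apply: esum_ge; exists [set x].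
  by split=> //; exact: finite_set1.
by rewrite fsbig_set1.
Qed.

Lemma l2norm_eq0 v : l2norm v = 0 -> v = 0.
Proof. by move=> v0; apply: sqnorm_eq0; rewrite -l2norm_sqr v0 expr0n. Qed.

Lemma sqnorm0 : sqnorm 0 = 0.
Proof.
by rewrite /sqnorm esum1// => x _; rewrite /l2term normc_sqr/= expr0n/= addr0.
Qed.

Lemma l2norm0 : l2norm (0 : l2 R G) = 0.
Proof. by rewrite /l2norm -/(sqnorm _) sqnorm0 sqrtr0. Qed.

Lemma sqnormZ (c : R[i]) v : sqnorm (c *: v) = normc c ^+ 2 * sqnorm v.
Proof.
have c0 : forall _ : unit, 0 <= normc c ^+ 2 by move=> _; exact: sqr_ge0.
have := esum_sum_sqnorm [:: tt] (fun=> v) c0; rewrite !big_seq1 => E.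
apply: EFin_inj; rewrite -sqnormE -E; apply: eq_esum => x _.
by rewrite big_seq1 -exprMn -normcM.
Qed.

Lemma l2normZ (c : R[i]) v : l2norm (c *: v) = normc c * l2norm v.
Proof.
rewrite /l2norm -!/(sqnorm _) sqnormZ sqrtrM ?sqr_ge0// sqrtr_sqr.
by rewrite ger0_norm// normc_ge0.
Qed.

(** With [a] and [b] the two norms, pointwise (p + q)^2 <= (a + b)/a p^2 + (a + b)/b q^2, the
    difference being (b p - a q)^2 / (a b). The right side sums to (a + b)^2. *)
Lemma le_l2normD v w : l2norm (v + w) <= l2norm v + l2norm w.
Proof.
have [v0|v0] := eqVneq (l2norm v) 0.
  by rewrite (l2norm_eq0 v0) l2norm0 !add0r.
have [w0|w0] := eqVneq (l2norm w) 0.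
  by rewrite (l2norm_eq0 w0) l2norm0 !addr0.
have {}v0 : 0 < l2norm v by rewrite lt0r v0 l2norm_ge0.
have {}w0 : 0 < l2norm w by rewrite lt0r w0 l2norm_ge0.
set a := l2norm v in v0 *; set b := l2norm w in w0 *.
apply: le_l2norm; first by rewrite addr_ge0// ltW.
pose k (i : bool) := (a + b) / (if i then a else b).
have := @le_sum_sqnorm _ _ [:: tt] [:: true; false] (fun=> 1) (fun=> v + w) k
  (fun i => if i then v else w).
rewrite !big_cons !big_nil /= !addr0 mul1r => H.
apply: le_trans (H _ _ _) _ => //.
- by case; rewrite /k divr_ge0// ?addr_ge0// ltW.
- move=> x; rewrite !big_cons !big_nil /= !addr0 mul1r.
  set p := normc (v x); set q := normc (w x).
  apply: (@le_trans _ _ ((p + q) ^+ 2)).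
    by rewrite ler_pXn2r ?nnegrE ?addr_ge0 ?normc_ge0// (@le_normcD R).
  rewrite /k -subr_ge0.
  have -> : (a + b) / a * p ^+ 2 + (a + b) / b * q ^+ 2 - (p + q) ^+ 2 =
      (b * p - a * q) ^+ 2 / (a * b) by field; rewrite !gt_eqF.
  by rewrite divr_ge0 ?sqr_ge0// mulr_ge0// ltW.
- rewrite -!l2norm_sqr -/a -/b /k.
  have -> // : (a + b) / a * a ^+ 2 + (a + b) / b * b ^+ 2 = (a + b) ^+ 2.
  by field; rewrite !gt_eqF.
Qed.

Lemma l2normN v : l2norm (- v) = l2norm v.
Proof.
rewrite -scaleN1r l2normZ; suff -> : normc (-1 : R[i]) = 1 by rewrite mul1r.
by rewrite (@normcN R) normc1.
Qed.

Lemma le_l2norm_sum (I : Type) (r : seq I) (f : I -> l2 R G) :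
  l2norm (\sum_(i <- r) f i) <= \sum_(i <- r) l2norm (f i).
Proof.
elim: r => [|i r IHr]; first by rewrite !big_nil l2norm0.
by rewrite !big_cons (le_trans (le_l2normD _ _))// lerD2l.
Qed.

Lemma lregE (g : G) v x : lreg g v x = v (g^-1 * x)%g. Proof. by []. Qed.

Lemma l2norm_lreg (g : G) v : l2norm (lreg g v) = l2norm v.
Proof.
rewrite /l2norm; congr (Num.sqrt (fine _)).
rewrite [RHS](reindex_esum setT setT (fun x => (g^-1 * x)%g)) //.
split=> [x //|x y _ _ /mulgI//|y _]; exists (g * y)%g => //=.
by rewrite mulKg.
Qed.

Lemma lreg_mul (g h : G) v : lreg (g * h)%g v = lreg g (lreg h v).
Proof. by apply: val_inj; apply/funext => x /=; rewrite invgM mulgA. Qed.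

Lemma lreg_one v : lreg 1%g v = v.
Proof. by apply: val_inj; apply/funext => x /=; rewrite invg1 mul1g. Qed.

Lemma lreg_linear (g : G) : linear (lreg g : l2 R G -> l2 R G).
Proof. by move=> c u v; apply: val_inj. Qed.

Lemma cutoff_subproof (B : set G) v :
  (fun x => if `[< B x >] then v x else 0) \in l2_pred (R := R) (G := G).
Proof.
rewrite l2_predE; apply: (@le_lt_trans _ _ (sqnorm v)%:E); last exact: ltry.
rewrite -sqnormE; apply: le_esum => x _; rewrite lee_fin.
by case: ifP => // _; rewrite normc0 expr0n sqr_ge0.
Qed.

Definition cutoff (B : set G) v : l2 R G := L2 (cutoff_subproof B v).

Lemma le_l2norm_cutoff B v : l2norm (cutoff B v) <= l2norm v.
Proof.
apply: le_l2norm (l2norm_ge0 _) _; rewrite l2norm_sqr -lee_fin -!sqnormE.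
apply: le_esum => x _; rewrite lee_fin /=.
by case: ifP => // _; rewrite normc0 expr0n sqr_ge0.
Qed.

(** Density of the finitely supported functions: a finite partial sum above [sqnorm v - e ^+ 2]
    leaves a remainder of norm at most [e]. *)
Lemma cutoff_finite v (e : R) : 0 < e ->
  exists2 A : set G, finite_set A & l2norm (v - cutoff A v) <= e.
Proof.
move=> e0; have : ((sqnorm v - e ^+ 2)%:E < \esum_(x in [set: G]) l2term v x)%E.
  by rewrite sqnormE lte_fin ltrBlDr ltrDl exprn_gt0.
move=> /ereal_sup_gt[_ [A [finA _] <-]] ltA; exists A => //.
apply: le_l2norm (ltW e0) _; rewrite -lee_fin -sqnormE.
have t0 x : [set: G] x -> (0 <= l2term v x)%E by move=> _; exact: l2term_ge0.
have := esumID A [set: G] (l2term v) t0; rewrite sqnormE !setTI.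
have -> : \esum_(x in A) l2term v x = (\sum_(x \in A) l2term v x)%E.
  by rewrite esum_fset// => x _; exact: l2term_ge0.
have -> : \esum_(x in ~` A) l2term v x =
    \esum_(x in [set: G]) l2term (v - cutoff A v) x.
  rewrite esum_mkcond; apply: eq_esum => x _.
  have E : (v - cutoff A v) x = v x - (if `[< A x >] then v x else 0) by [].
  rewrite {2}/l2term E in_setC.
  have -> : (x \in A) = `[< A x >] by apply/idP/asboolP; rewrite inE.
  by case: ifP; case: asboolP => // _ _; rewrite ?subr0// subrr normc0 expr0n.
rewrite sqnormE; move: ltA; have := @fsume_ge0 _ _ A (l2term v)
  (fun x _ => l2term_ge0 v x).
case: (X in (0 <= X)%E) => [s|_ _|]; [|by rewrite addye|by []].
rewrite lee_fin lte_fin -EFinD => _ lts [E].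
by rewrite lee_fin; lra.
Qed.

End L2Norm.

(** * Operators on the Hilbert space *)

Section Operators.
Variables (R : realType) (G : groupType).
Implicit Types (u v w : l2 R G) (T S : l2 R G -> l2 R G).

Section Linear.
Variables (T : l2 R G -> l2 R G) (linT : linear T).

Lemma linop0 : T 0 = 0.
Proof. by have := linT (-1) 0 0; rewrite scaler0 addr0 scaleN1r addNr. Qed.

Lemma linopZ (c : R[i]) v : T (c *: v) = c *: T v.
Proof. by rewrite -[c *: v]addr0 linT linop0 addr0. Qed.

Lemma linopD v w : T (v + w) = T v + T w.
Proof. by rewrite -[v in LHS]scale1r linT scale1r. Qed.

Lemma linopB v w : T (v - w) = T v - T w.
Proof. by rewrite linopD -scaleN1r linopZ scaleN1r. Qed.

Lemma linop_sum (I : Type) (r : seq I) (f : I -> l2 R G) :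
  T (\sum_(i <- r) f i) = \sum_(i <- r) T (f i).
Proof.
by elim: r => [|i r IHr]; rewrite ?big_nil ?linop0// !big_cons linopD IHr.
Qed.

End Linear.

Lemma normc_real (x : R) : normc (x%:C)%C = `|x|.
Proof. by rewrite /= expr0n /= addr0 sqrtr_sqr. Qed.

Lemma opnorm_bound T v : bounded_op T -> l2norm (T v) <= opnorm T * l2norm v.
Proof.
move=> [linT [M TM]].
have [v0|v0] := eqVneq (l2norm v) 0.
  by rewrite (l2norm_eq0 v0) (linop0 linT) !l2norm0 mulr0.
have {}v0 : 0 < l2norm v by rewrite lt0r v0 l2norm_ge0.
rewrite -ler_pdivrMr//.
have -> : l2norm (T v) / l2norm v = l2norm (T (((l2norm v)^-1)%:C%C *: v)).
  rewrite (linopZ linT) l2normZ normc_real ger0_norm ?invr_ge0 ?ltW//.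
  by rewrite mulrC.
(* Boundedness of [T] provides the upper bound that keeps [sup] from taking its default value 0. *)
apply: ub_le_sup.
  exists `|M| => _ [w /= w1 <-]; apply: (le_trans (TM w)).
  rewrite -[leRHS]mulr1; apply: (@le_trans _ _ (`|M| * l2norm w)).
    by rewrite ler_wpM2r ?l2norm_ge0// ler_norm.
  by rewrite ler_wpM2l.
exists (((l2norm v)^-1)%:C%C *: v) => //=.
by rewrite l2normZ normc_real ger0_norm ?invr_ge0 ?(ltW v0)// mulVf// gt_eqF.
Qed.

Lemma opnorm_le T (M : R) : 0 <= M ->
  (forall v, l2norm (T v) <= M * l2norm v) -> opnorm T <= M.
Proof.
move=> M0 TM; apply: ge_sup.
  by exists (l2norm (T 0)), 0 => //=; rewrite l2norm0.
move=> _ [v /= v1 <-]; apply: (le_trans (TM v)).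
by rewrite -[leRHS]mulr1 ler_wpM2l.
Qed.

Lemma bounded_opB T S : bounded_op T -> bounded_op S -> bounded_op (T - S).
Proof.
move=> [linT [M TM]] [linS [N SN]]; split.
  move=> c u v; rewrite -[LHS]/(T _ - S _) linT linS.
  rewrite -[X in _ = _ *: X + _]/(T u - S u) -[X in _ = _ + X]/(T v - S v).
  by rewrite scalerBr addrACA opprD.
exists (M + N) => v; rewrite -[(T - S) v]/(T v - S v) mulrDl.
by apply: (le_trans (le_l2normD _ _)); rewrite l2normN lerD.
Qed.

Lemma group_algebra_bound (s : seq G) (c : G -> R[i]) v :
  l2norm (\sum_(g <- s) c g *: lreg g v) <=
  (\sum_(g <- s) normc (c g)) * l2norm v.
Proof.
apply: (le_trans (le_l2norm_sum _ _)); rewrite mulr_suml ler_sum// => g _.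
by rewrite l2normZ l2norm_lreg.
Qed.

Lemma sum_opE (I : Type) (r : seq I) (f : I -> l2 R G -> l2 R G) v :
  (\sum_(i <- r) f i) v = \sum_(i <- r) f i v.
Proof. by elim: r => [|i r IHr]; rewrite ?big_nil// !big_cons -IHr. Qed.

Lemma sum_l2E (I : Type) (r : seq I) (f : I -> l2 R G) x :
  (\sum_(i <- r) f i) x = \sum_(i <- r) f i x.
Proof. by elim: r => [|i r IHr]; rewrite ?big_nil// !big_cons -IHr. Qed.

Lemma group_algebraE (s : seq G) (c : G -> R[i]) v :
  (\sum_(g <- s) c g *: lreg g) v = \sum_(g <- s) c g *: lreg g v.
Proof. by rewrite sum_opE. Qed.

Lemma group_algebra_bounded T : group_algebra_op T -> bounded_op T.
Proof.
move=> [s [c ->]]; split.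
  move=> a u v; rewrite !group_algebraE scaler_sumr -big_split/=.
  by apply: eq_bigr => g _; rewrite lreg_linear scalerDr !scalerA mulrC.
exists (\sum_(g <- s) normc (c g)) => v.
by rewrite group_algebraE group_algebra_bound.
Qed.

Lemma group_algebra_reduced T : group_algebra_op T -> reduced_Cstar T.
Proof.
move=> gT; have bT := group_algebra_bounded gT; split=> // e e0.
exists T; split=> //; apply: le_lt_trans e0; apply: opnorm_le => // v.
by rewrite subrr l2norm0 mul0r.
Qed.

Lemma reduced_lreg (g : G) : reduced_Cstar (lreg g : l2 R G -> l2 R G).
Proof.
apply: group_algebra_reduced; exists [:: g], (fun=> 1).
by rewrite big_seq1 scale1r.
Qed.

Lemma delta_subproof (g : G) :
  (fun x => (x == g)%:R) \in l2_pred (R := R) (G := G).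
Proof.
rewrite l2_predE (_ : esum _ _ = 1%:E) ?ltry//.
rewrite -(@esum_set1 _ _ g (fun=> 1%:E)) ?lee_fin//.
rewrite [RHS]esum_mkcond; apply: eq_esum => x _; rewrite /l2term.
have -> : (x \in [set g]) = (x == g) by apply/idP/eqP; rewrite inE.
by case: eqP => _; rewrite ?normc1 ?expr1n// normc0 expr0n.
Qed.

Definition delta (g : G) : l2 R G := L2 (delta_subproof g).

Lemma deltaE g x : delta g x = (x == g)%:R. Proof. by []. Qed.

Lemma l2norm_delta g : l2norm (delta g) = 1.
Proof.
rewrite /l2norm -[RHS]sqrtr1; congr Num.sqrt.
rewrite -[RHS]/(fine 1%:E); congr fine.
rewrite -(@esum_set1 _ _ g (fun=> 1%:E)) ?lee_fin//.
rewrite [RHS]esum_mkcond; apply: eq_esum => x _; rewrite /l2term deltaE.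
have -> : (x \in [set g]) = (x == g) by apply/idP/eqP; rewrite inE.
by case: eqP => _; rewrite ?normc1 ?expr1n// normc0 expr0n.
Qed.

Lemma normc_le_eq0 (z : R[i]) : (forall e : R, 0 < e -> normc z <= e) -> z = 0.
Proof.
move=> h; apply: eq0_normc; apply/eqP; rewrite eq_le normc_ge0 andbT.
by apply/ler_addgt0Pl => e e0; rewrite addr0 h.
Qed.

(** The operators [lreg g] commute with right translations, and this survives finite combinations
    and norm limits. *)
Lemma reduced_deltaE T (h x : G) : reduced_Cstar T ->
  T (delta h) x = T (delta 1%g) (x * h^-1)%g.
Proof.
move=> [bT limT]; apply/eqP; rewrite -subr_eq0; apply/eqP.
apply: normc_le_eq0 => e e0.
have [|S [[s [c ->]] bS TS]] := limT (e / 2); first by rewrite divr_gt0.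
set S' := (X in T - X) in bS TS *.
have SvE v : S' v = \sum_(g <- s) c g *: lreg g v by exact: group_algebraE.
have SE : S' (delta h) x = S' (delta 1%g) (x * h^-1)%g.
  rewrite !SvE !sum_l2E; apply: eq_bigr => g _; congr (_ * _).
  rewrite -[LHS]/((_ == _)%:R) -[RHS]/((_ == _)%:R).
  by rewrite mulgA divg_eq mul1g.
have d g y : normc (T (delta g) y - S' (delta g) y) <= e / 2.
  apply: le_trans (le_normc_l2norm (T (delta g) - S' (delta g)) y) _.
  apply: le_trans (opnorm_bound (delta g) (bounded_opB bT bS)) _.
  by rewrite l2norm_delta mulr1 ltW.
have -> : T (delta h) x - T (delta 1%g) (x * h^-1)%g =
    (T (delta h) x - S' (delta h) x) -
    (T (delta 1%g) (x * h^-1)%g - S' (delta 1%g) (x * h^-1)%g).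
  by rewrite SE; ring.
apply: le_trans (@le_normcD R _ _) _; rewrite (@normcN R).
by rewrite (splitr e) lerD.
Qed.

(** [delta 1] is a separating vector: by right translation [T] kills every [delta g], hence all
    finitely supported functions, which are dense. *)
Lemma reduced_eq0 T : reduced_Cstar T -> T (delta 1%g) = 0 -> T = 0.
Proof.
move=> redT T1; have [linT [M TM]] := redT.1.
have Td g : T (delta g) = 0.
  by apply: val_inj; apply/funext => x; rewrite /= reduced_deltaE// T1.
have Tfin (A : set G) v : finite_set A -> T (cutoff A v) = 0.
  move=> /finite_seqP[X ->].
  have -> : cutoff [set` X] v = \sum_(x <- undup X) v x *: delta x.
    apply: val_inj; apply/funext => x; rewrite /= sum_l2E.
    case: asboolP => /= xX.
      rewrite (bigD1_seq x) ?undup_uniq ?mem_undup//= big1 => [|y yx].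
        by rewrite addr0 -[RHS]/(_ * (_ == _)%:R) eqxx mulr1.
      by rewrite -[LHS]/(_ * (_ == _)%:R) eq_sym (negbTE yx) mulr0.
    rewrite big_seq big1// => y; rewrite mem_undup => yX.
    rewrite -[LHS]/(_ * (_ == _)%:R).
    by case: eqP => [xy|]; rewrite ?mulr0//; case: xX; rewrite xy.
  by rewrite (linop_sum linT) big1// => x _; rewrite (linopZ linT) Td scaler0.
apply/funext => v; apply: l2norm_eq0; apply/eqP.
rewrite eq_le l2norm_ge0 andbT; apply/ler_addgt0Pl => e e0; rewrite addr0.
(* The summand 1 keeps the denominator positive. *)
have d0 : 0 < e / (`|M| + 1) by rewrite divr_gt0// ltr_wpDl.
have [A finA vA] := cutoff_finite v d0.
have -> : T v = T (v - cutoff A v) by rewrite (linopB linT) Tfin// subr0.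
apply: le_trans (TM _) _; apply: (@le_trans _ _ ((`|M| + 1) * (e / (`|M| + 1)))).
  apply: (@le_trans _ _ (`|M| * l2norm (v - cutoff A v))).
    by rewrite ler_wpM2r ?l2norm_ge0// ler_norm.
  by rewrite ler_pM// ?l2norm_ge0// lerDl.
by rewrite mulrC divfK// gt_eqF// ltr_wpDl.
Qed.

End Operators.

(** * Powers' criterion *)

(** In the second clause, the translates by the [gam i] of the complement of [C] are pairwise
    disjoint. *)
Definition powers_property (G : groupType) : Prop :=
  forall (F : seq G) (N : nat), 1%g \notin F ->
  exists (C : set G) (gam : 'I_N -> G),
    (forall f x, f \in F -> C x -> ~ C (f * x)%g) /\
    (forall i j x, i != j -> C ((gam i)^-1 * x)%g \/ C ((gam j)^-1 * x)%g).

Section PowersBound.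
Variables (R : realType) (G : groupType).
Implicit Types (u v w : l2 R G) (T S : l2 R G -> l2 R G).

Lemma cutoffC (B : set G) v : cutoff B v + cutoff (~` B) v = v.
Proof.
apply: val_inj; apply/funext => x.
rewrite -[LHS]/((if `[< B x >] then v x else 0) +
                (if `[< (~` B) x >] then v x else 0)).
rewrite asbool_neg; case: asboolP => _; by rewrite ?addr0 ?add0r.
Qed.

(** Cauchy-Schwarz for [K ^ 2] terms, from a <= (K/b a^2 + b/K)/2 in each term. A square number of
    terms avoids the square root of [N]. *)
Lemma sqr_sum_le (N K : nat) (a : 'I_N -> R) (b : R) : (0 < K)%N ->
  N = (K ^ 2)%N -> 0 < b ->
  \sum_i a i ^+ 2 <= b ^+ 2 -> \sum_i a i <= K%:R * b.
Proof.
move=> K0 NK b0 ab.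
have K0' : 0 < K%:R :> R by rewrite ltr0n.
apply: (@le_trans _ _ (\sum_i (K%:R / b * a i ^+ 2 + b / K%:R) / 2)).
  apply: ler_sum => i _; rewrite -subr_ge0.
  have -> : (K%:R / b * a i ^+ 2 + b / K%:R) / 2 - a i =
      (K%:R * a i - b) ^+ 2 / (2 * b * K%:R).
    by field; rewrite !gt_eqF.
  by rewrite divr_ge0 ?sqr_ge0// !mulr_ge0// ltW.
have NR : N%:R = K%:R ^+ 2 :> R by rewrite NK natrX.
rewrite -mulr_suml big_split/= -mulr_sumr sumr_const card_ord.
rewrite -[X in _ + X]mulr_natr NR.
have : K%:R / b * \sum_i a i ^+ 2 <= K%:R / b * b ^+ 2.
  by rewrite ler_wpM2l// divr_ge0// ltW.
have -> : K%:R / b * b ^+ 2 = K%:R * b by field; rewrite gt_eqF.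
have -> : b / K%:R * K%:R ^+ 2 = K%:R * b by field; rewrite gt_eqF.
lra.
Qed.

Variables (C : set G) (N K : nat) (gam : 'I_N -> G).
Hypotheses (K0 : (0 < K)%N) (NK : N = (K ^ 2)%N).
Hypothesis Cgam : forall i j x, i != j ->
  C ((gam i)^-1 * x)%g \/ C ((gam j)^-1 * x)%g.
Variables (X : l2 R G -> l2 R G) (M : R).
Hypotheses (linX : linear X) (XM : forall v, l2norm (X v) <= M * l2norm v).
Hypothesis XC : forall w, cutoff (~` C) w = 0 -> forall x, C x -> X w x = 0.

(* With [p_i] the projection onto the functions supported on [gam_i D], where
   [D = ~` C], each conjugate [y_i] of [X] satisfies
   [(1 - p_i) y_i (1 - p_i) = 0], that is, [y_i = p_i y_i + (1 - p_i) y_i p_i];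
   the ranges of the [p_i] are pairwise orthogonal. *)
Lemma powers_bound v :
  l2norm (\sum_i lreg (gam i) (X (lreg (gam i)^-1%g v))) <=
  2 * M * K%:R * l2norm v.
Proof.
have K0' : 0 < K%:R :> R by rewrite ltr0n.
have [v0|v0] := eqVneq (l2norm v) 0.
  rewrite v0 mulr0; apply: (le_trans (le_l2norm_sum _ _)).
  rewrite big1// => i _; rewrite l2norm_lreg; apply/eqP.
  rewrite eq_le l2norm_ge0 andbT; apply: (le_trans (XM _)).
  by rewrite l2norm_lreg v0 mulr0.
have {}v0 : 0 < l2norm v by rewrite lt0r v0 l2norm_ge0.
have M0 : 0 <= M.
  rewrite -(@pmulr_lge0 _ (l2norm v))//; apply: le_trans (XM v).
  exact: l2norm_ge0.
pose y i w := lreg (gam i) (X (lreg (gam i)^-1%g w)).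
pose D i : set G := [set x | ~ C ((gam i)^-1 * x)%g].
have yM i w : l2norm (y i w) <= M * l2norm w.
  by rewrite l2norm_lreg (le_trans (XM _))// l2norm_lreg.
have yD i u w : y i (u + w) = y i u + y i w.
  rewrite /y -(linopD (@lreg_linear R G (gam i))) -(linopD linX).
  by rewrite -(linopD (@lreg_linear R G (gam i)^-1%g)).
(* This is [XC] conjugated by [gam i]: the complement of [D i] is the translate of [C]. *)
have y0 i : cutoff (~` D i) (y i (cutoff (~` D i) v)) = 0.
  apply: val_inj; apply/funext => x.
  rewrite -[LHS]/(if `[< (~` D i) x >] then y i (cutoff (~` D i) v) x else 0).
  case: asboolP => // /notP Cx; rewrite /y lregE XC//.
  apply: val_inj; apply/funext => z.
  rewrite -[LHS]/(if `[< ~ C z >] then cutoff (~` D i) v ((gam i)^-1^-1 * z)%g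
                  else 0).
  case: asboolP => // nCz.
  rewrite -[LHS]/(if `[< ~ ~ C ((gam i)^-1 * ((gam i)^-1^-1 * z))%g >] then _
                  else 0).
  by rewrite mulVKg; case: asboolP => // /notP /nCz.
have yE i : y i v = cutoff (D i) (y i v) + cutoff (~` D i) (y i (cutoff (D i) v)).
  rewrite -[LHS](cutoffC (D i)); congr (_ + _).
  rewrite -{1}(cutoffC (D i) v) yD.
  have cD (B : set G) u w : cutoff B (u + w) = cutoff B u + cutoff B w.
    apply: val_inj; apply/funext => x.
    rewrite -[LHS]/(if `[< B x >] then u x + w x else 0).
    rewrite -[RHS]/((if `[< B x >] then u x else 0) +
                    (if `[< B x >] then w x else 0)).
    by case: ifP; rewrite ?addr0.
  by rewrite cD y0 addr0.
have Duniq i j x : D i x -> D j x -> i = j.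
  by move=> Di Dj; apply/eqP/negPn/negP => ij; case: (Cgam x ij).
under eq_bigr do rewrite -/(y _ v) yE.
rewrite big_split/=; apply: (le_trans (le_l2normD _ _)).
have -> : 2 * M * K%:R * l2norm v =
    K%:R * (M * l2norm v) + M * (K%:R * l2norm v) by ring.
apply: lerD.
  (* At each point at most one of the cutoffs is nonzero, so the squared norms of the [K ^ 2] terms
     add up. *)
  apply: le_l2norm; first by rewrite !mulr_ge0// ltW.
  have := @le_sum_sqnorm R G _ _ [:: tt] (index_enum 'I_N) (fun=> 1)
    (fun=> \sum_i cutoff (D i) (y i v)) (fun=> 1) (fun i => y i v).
  rewrite big_seq1 mul1r => /(_ _ _ _)/le_trans; apply => //.
    move=> x; rewrite big_seq1 mul1r sum_l2E.
    have [[i Dix]|nD] := pselect (exists i, D i x); last first.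
      rewrite big1 => [|i _].
        by rewrite normc0 expr0n sumr_ge0// => i _; rewrite mul1r sqr_ge0.
      rewrite -[LHS]/(if `[< D i x >] then _ else _).
      by case: asboolP => // Dix; case: nD; exists i.
    rewrite (bigD1 i)//= big1 => [|j ji].
      rewrite addr0 (bigD1 i)//= mul1r.
      rewrite -[normc _]/(normc (if `[< D i x >] then y i v x else 0)).
      rewrite asboolT// lerDl sumr_ge0// => j _.
      by rewrite mul1r sqr_ge0.
    rewrite -[LHS]/(if `[< D j x >] then _ else _).
    by case: asboolP => // Djx; rewrite (Duniq _ _ _ Djx Dix) eqxx in ji.
  apply: (@le_trans _ _ (\sum_(i < N) (M * l2norm v) ^+ 2)).
    apply: ler_sum => i _; rewrite mul1r -l2norm_sqr.
    by rewrite ler_pXn2r ?nnegrE ?l2norm_ge0// mulr_ge0// ltW.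
  have NR : N%:R = K%:R ^+ 2 :> R by rewrite NK natrX.
  by rewrite sumr_const card_ord -[X in X <= _]mulr_natl NR -exprMn.
(* Here the pieces of [v] on the disjoint sets [D i] have squared norms adding up to at most that of
   [v], and Cauchy-Schwarz applies. *)
apply: (le_trans (le_l2norm_sum _ _)).
apply: (@le_trans _ _ (\sum_i M * l2norm (cutoff (D i) v))).
  by apply: ler_sum => i _; rewrite (le_trans (le_l2norm_cutoff _ _)).
rewrite -mulr_sumr ler_wpM2l//; apply: sqr_sum_le => //.
rewrite l2norm_sqr.
have := @le_sum_sqnorm R G _ _ (index_enum 'I_N) [:: tt] (fun=> 1)
  (fun i => cutoff (D i) v) (fun=> 1) (fun=> v).
have -> : \sum_i l2norm (cutoff (D i) v) ^+ 2 =
    \sum_i 1 * sqnorm (cutoff (D i) v).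
  by apply: eq_bigr => i _; rewrite mul1r l2norm_sqr.
rewrite big_seq1 mul1r; apply => // x; rewrite big_seq1 mul1r.
have [[i Dix]|nD] := pselect (exists i, D i x); last first.
  rewrite big1 ?sqr_ge0// => i _; rewrite mul1r /=.
  case: asboolP => [Dix|_]; last by rewrite normc0 expr0n.
  by case: nD; exists i.
rewrite (bigD1 i)//= big1 => [|j ji].
  by rewrite addr0 mul1r; case: asboolP => // _; rewrite normc0 expr0n sqr_ge0.
rewrite mul1r /=; case: asboolP => [Djx|_]; last by rewrite normc0 expr0n.
by rewrite (Duniq _ _ _ Djx Dix) eqxx in ji.
Qed.

End PowersBound.

(** * Ideals of the reduced algebra, and simplicity from Powers' property *)

Section Simple.
Variables (R : realType) (G : groupType).
Implicit Types (u v w : l2 R G) (T S : l2 R G -> l2 R G).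
Variable I : set (l2 R G -> l2 R G).
Hypothesis idI : closed_ideal (reduced_Cstar (R := R) (G := G)) I.

Lemma ideal_reduced T : I T -> reduced_Cstar T.
Proof. by case: idI => + _ _ _ _; apply. Qed.

Lemma idealD T S : I T -> I S -> I (T + S).
Proof.
by case: idI => _ _ lin _ _ IT IS; rewrite -[T]scale1r; exact: lin.
Qed.

Lemma idealZ (c : R[i]) T : I T -> I (c *: T).
Proof. by case: idI => _ I0 lin _ _ IT; rewrite -[_ *: _]addr0; exact: lin. Qed.

Lemma ideal_sum (J : Type) (r : seq J) (f : J -> l2 R G -> l2 R G) :
  (forall j, I (f j)) -> I (\sum_(j <- r) f j).
Proof.
move=> If; elim: r => [|j r IHr]; first by rewrite big_nil; case: idI.
by rewrite big_cons; exact: idealD.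
Qed.

Lemma ideal_compl S T : reduced_Cstar S -> I T -> I (S \o T).
Proof. by case: idI => _ _ _ comp _ rS IT; case: (comp S T). Qed.

Lemma ideal_compr S T : I T -> reduced_Cstar S -> I (T \o S).
Proof. by case: idI => _ _ _ comp _ IT rS; case: (comp S T). Qed.

(* [1 - (1 - U) ^ n] lies in the ideal and tends to [1]. *)
Lemma ideal_near_id (U : l2 R G -> l2 R G) : I U ->
  (forall v, l2norm (v - U v) <= 2^-1 * l2norm v) -> I id.
Proof.
move=> IU Uid; have [_ _ _ _ clI] := idI; apply: clI.
pose X n := iter n (fun Y : l2 R G -> l2 R G => U + Y - (Y \o U)) 0.
have IX n : I (X n).
  elim: n => [|n IHn]; first by case: idI.
  rewrite /X iterS -/(X n) -scaleN1r; apply: idealD; first exact: idealD.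
  by apply: idealZ; apply: ideal_compr => //; exact: ideal_reduced.
have Xid n v : l2norm (v - X n v) <= 2^-1 ^+ n * l2norm v.
  elim: n v => [|n IHn] v; first by rewrite subr0 expr0 mul1r.
  have linX : linear (X n) by have [[]] := ideal_reduced (IX n).
  have -> : v - X n.+1 v = (v - U v) - X n (v - U v).
    rewrite (linopB linX) /X iterS -/(X n).
    rewrite -[(U + X n - (X n \o U)) v]/(U v + X n v - X n (U v)).
    by rewrite !opprD !opprK !addrA.
  apply: (le_trans (IHn _)).
  by rewrite exprSr -mulrA ler_wpM2l ?exprn_ge0 ?invr_ge0.
have bid : bounded_op (id : l2 R G -> l2 R G).
  by split=> //; exists 1 => v; rewrite mul1r.
(* This [n] works because e^-1 < n + 1 <= 2^n. *)
split=> // e e0; pose n := Num.trunc (e^-1); exists (X n).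
have bX : bounded_op (X n) by have [] := ideal_reduced (IX n).
split=> //; apply: (@le_lt_trans _ _ (2^-1 ^+ n)).
  by apply: opnorm_le => // v; exact: Xid.
rewrite exprVn -[e]invrK ltf_pV2 ?posrE ?exprn_gt0 ?invr_gt0//.
have /andP[_ ltn] : (n%:R <= e^-1 < n.+1%:R) by rewrite trunc_itv// invr_ge0 ltW.
apply: lt_le_trans ltn _; rewrite -natrX ler_nat; exact: ltn_expl.
Qed.

End Simple.

(** A nonzero ideal contains some [T'] with coefficient 1 at the identity. Averaging conjugates of
    [T'] keeps that coefficient and makes the rest small, so the average is near the identity. *)
Lemma powers_Cstar_simple (R : realType) (G : groupType) :
  powers_property G -> Cstar_simple R G.
Proof.
move=> powG I idI.
have [[T [IT T0]]|nT] := pselect (exists T, I T /\ T <> 0); last first.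
  left; apply/seteqP; split=> [T IT|_ ->]; last by case: idI.
  by apply: contrapT => T0; apply: nT; exists T.
right; suff I1 : I id.
  apply/seteqP; split=> [S|S rS]; first exact: ideal_reduced.
  exact: (ideal_compl idI rS I1).
have redT := ideal_reduced idI IT.
have [g Tg] : exists g, T (delta R 1%g) g != 0.
  apply: contrapT => h; apply: T0; apply: reduced_eq0 => //.
  apply: val_inj; apply/funext => g /=; apply/eqP/negPn/negP => Tg.
  by apply: h; exists g.
(* A translate and a scalar move the nonzero coefficient at [g] to the identity and make it 1. *)
pose T' := (T (delta R 1%g) g)^-1 *: (lreg g^-1%g \o T).
have IT' : I T'.
  exact (idealZ idI _ (ideal_compl idI (reduced_lreg _ _) IT)).
have T'1 : T' (delta R 1%g) 1%g = 1.
  rewrite -[LHS]/((T (delta R 1%g) g)^-1 * T (delta R 1%g) (g^-1^-1 * 1)%g).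
  by rewrite invgK mulg1 mulVf.
have redT' := ideal_reduced idI IT'.
clearbody T'.
(* The tolerance 1/8 is spent twice, on [T' - S] and on [1 - c0]. The choice of [K] below makes the
   remaining term 2 M / K less than 1/8, so the total stays below 1/2. *)
have [|S [[s [c SE]] bS TS]] := redT'.2 (8^-1); first by rewrite invr_gt0.
have Sv v : S v = \sum_(h <- s) c h *: lreg h v by rewrite SE group_algebraE.
have TSv v : l2norm (T' v - S v) <= 8^-1 * l2norm v.
  apply: (le_trans (opnorm_bound v (bounded_opB redT'.1 bS))).
  by rewrite ler_wpM2r ?l2norm_ge0// ltW.
pose c0 := \sum_(h <- s | h == 1%g) c h.
pose F := [seq h <- s | h != 1%g].
pose X v := \sum_(h <- F) c h *: lreg h v.
have SX v : S v = c0 *: v + X v.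
  rewrite Sv (bigID (fun h => h == 1%g))/= /X big_filter; congr (_ + _).
  by rewrite scaler_suml; apply: eq_bigr => h /eqP ->; rewrite lreg_one.
have c01 : normc (1 - c0) <= 8^-1.
  have <- : (T' (delta R 1%g) - S (delta R 1%g)) 1%g = 1 - c0.
    have -> : (T' (delta R 1%g) - S (delta R 1%g)) 1%g =
      T' (delta R 1%g) 1%g - S (delta R 1%g) 1%g by [].
    rewrite T'1 SX; congr (_ - _).
    have -> : (c0 *: delta R 1%g + X (delta R 1%g)) 1%g =
      c0 * (1%g == 1%g :> G)%:R + X (delta R 1%g) 1%g by [].
    rewrite eqxx mulr1 /X sum_l2E big_seq big1 ?addr0// => h.
    rewrite mem_filter => /andP[h1 _].
    rewrite -[LHS]/(c h * ((h^-1 * 1)%g == 1%g :> G)%:R) mulg1 invg_eq1.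
    by rewrite (negbTE h1) mulr0.
  apply: le_trans (le_normc_l2norm _ _) _; apply: (le_trans (TSv _)).
  by rewrite l2norm_delta mulr1.
pose M := \sum_(h <- F) normc (c h).
have M0 : 0 <= M by rewrite sumr_ge0// => h _; exact: normc_ge0.
have XM v : l2norm (X v) <= M * l2norm v by exact: group_algebra_bound.
have linX : linear X.
  have [] : bounded_op (\sum_(h <- F) c h *: lreg h : l2 R G -> l2 R G).
    by apply: group_algebra_bounded; exists F, c.
  have -> // : \sum_(h <- F) c h *: lreg h = X.
  by apply/funext => v; rewrite group_algebraE.
pose K := (Num.trunc (16 * M)).+1.
have KM : 16 * M < K%:R.
  have /andP[] // : ((Num.trunc (16 * M))%:R <= 16 * M < K%:R).
  by rewrite trunc_itv// mulr_ge0.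
have K0 : 0 < K%:R :> R by rewrite ltr0n.
have [|C [gam [CF Cgam]]] := powG F (K ^ 2)%N.
  by rewrite mem_filter eqxx.
have XC w : cutoff (~` C) w = 0 -> forall x, C x -> X w x = 0.
  move=> w0 x Cx; rewrite /X sum_l2E big_seq big1// => h hF.
  rewrite -[LHS]/(_ * w (h^-1 * x)%g).
  have -> : w (h^-1 * x)%g = 0; last by rewrite mulr0.
  have : cutoff (~` C) w (h^-1 * x)%g = 0 by rewrite w0.
  rewrite /=; case: asboolP => // /notP Chx _.
  by case: (CF _ _ hF Chx); rewrite mulVKg.
pose U := (K%:R ^- 2)%:C%C *:
  \sum_i (lreg (gam i) \o (T' \o lreg (gam i)^-1%g)).
apply: (@ideal_near_id _ _ _ idI U).
  apply: (idealZ idI); apply: (ideal_sum idI) => i.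
  apply: (ideal_compl idI (reduced_lreg _ _)).
  exact (ideal_compr idI IT' (reduced_lreg _ _)).
move=> v.
pose V i := lreg (gam i)^-1%g v.
have lregVK i : lreg (gam i) (V i) = v by rewrite -lreg_mul mulgV lreg_one.
have US : U v = (K%:R ^- 2)%:C%C *: \sum_i lreg (gam i) (T' (V i)).
  by rewrite -[LHS]/(_ *: (\sum_i _) v) sum_opE.
have vE : v = (K%:R ^- 2)%:C%C *: \sum_(i < K ^ 2) v.
  rewrite sumr_const card_ord -scaler_nat scalerA natrX.
  have -> : (K%:R : R[i]) = real_complex R K%:R by rewrite rmorph_nat.
  rewrite -(rmorphXn (real_complex R)) -(rmorphM (real_complex R)).
  by rewrite mulVf ?(rmorph1 (real_complex R)) ?scale1r// expf_neq0// gt_eqF.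
have -> : v - U v = (K%:R ^- 2)%:C%C *:
    (\sum_i lreg (gam i) ((S (V i) - T' (V i)) + (1 - c0) *: V i) -
     \sum_i lreg (gam i) (X (V i))).
  rewrite US {1}vE -scalerBr -!sumrB; congr (_ *: _).
  apply: eq_bigr => i _; rewrite -[in LHS](lregVK i).
  have linlB := linopB (@lreg_linear R G (gam i)).
  rewrite -!linlB SX; congr (lreg _ _).
  have zmod (Z : zmodType) (a b d e : Z) : e - d = a + b - d + (e - a) - b.
    by rewrite -addrA -[e - a - b]addrA -opprD addrC addrA subrK.
  by rewrite scalerBl scale1r; exact: zmod.
rewrite l2normZ normc_real ger0_norm ?invr_ge0 ?sqr_ge0//.
rewrite mulrC ler_pdivrMr ?exprn_gt0//.
apply: (le_trans (le_l2normD _ _)); rewrite l2normN.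
apply: (@le_trans _ _ (\sum_(i < K ^ 2) (4^-1 * l2norm v) +
    2 * M * K%:R * l2norm v)).
  apply: lerD.
    apply: (le_trans (le_l2norm_sum _ _)); apply: ler_sum => i _.
    rewrite l2norm_lreg; apply: (le_trans (le_l2normD _ _)).
    have -> : 4^-1 * l2norm v = 8^-1 * l2norm v + 8^-1 * l2norm v by field.
    have <- : l2norm (V i) = l2norm v by exact: l2norm_lreg.
    apply: lerD; first by rewrite -l2normN opprB.
    by rewrite l2normZ ler_wpM2r ?l2norm_ge0.
  by apply: (@powers_bound R G C (K ^ 2) K gam) => //; rewrite ltn0Sn.
rewrite sumr_const card_ord -[X in X + _]mulr_natl natrX.
rewrite -subr_ge0.
have -> : 2^-1 * l2norm v * K%:R ^+ 2 - (K%:R ^+ 2 * (4^-1 * l2norm v) +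
    2 * M * K%:R * l2norm v) = (K%:R * l2norm v / 8) * (2 * K%:R - 16 * M).
  by field.
rewrite mulr_ge0// ?divr_ge0 ?mulr_ge0 ?l2norm_ge0//; lra.
Qed.

(** * Presented groups *)

Section IntPower.
Variable G : groupType.
Implicit Types (x y g : G) (m n k : int).

Lemma expgz0 x : expgz x 0 = 1%g. Proof. exact: expg0. Qed.

Lemma expgz1 x : expgz x 1 = x. Proof. exact: expg1. Qed.

Lemma expgz_nat x (n : nat) : expgz x n = (x ^+ n)%g. Proof. by []. Qed.

Lemma expgzN x n : expgz x (- n) = (expgz x n)^-1%g.
Proof.
case: n => [[|n]|n]; first by rewrite oppr0 expgz0 invg1.
  by rewrite -NegzE.
by rewrite NegzE opprK /= invgK.
Qed.

Lemma expgz1D x n : expgz x (1 + n) = (x * expgz x n)%g.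
Proof.
case: n => [n|[|n]]; first by rewrite -PoszD add1n /= expgS.
  by rewrite NegzE addrN /= expg0 expg1 mulgV.
rewrite NegzE -{1}(add1n n.+1) PoszD opprD addrA subrr add0r expgzN /=.
by rewrite (expgSr x n.+1) invgM mulVKg.
Qed.

Lemma expgzD x m n : expgz x (m + n) = (expgz x m * expgz x n)%g.
Proof.
elim/int_rect: m => [|m IHm|m IHm]; first by rewrite add0r expgz0 mul1g.
  by rewrite -(add1n m) PoszD -addrA !expgz1D IHm mulgA.
apply: (mulgI x); rewrite -expgz1D addrA mulgA -expgz1D.
by rewrite -(add1n m) PoszD opprD addrA subrr add0r IHm.
Qed.

Lemma expgz_commute x m n :
  (expgz x m * expgz x n)%g = (expgz x n * expgz x m)%g.
Proof. by rewrite -!expgzD addrC. Qed.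

Lemma expgzM x m n : expgz x (m * n) = expgz (expgz x m) n.
Proof.
elim/int_rect: n => [|n IHn|n IHn]; first by rewrite mulr0.
  by rewrite -(add1n n) PoszD mulrDr mulr1 !expgzD IHn expgz1.
rewrite -(add1n n) PoszD opprD mulrDr mulrN1 !expgzD IHn.
by rewrite !expgzN expgz1.
Qed.

Lemma expgz_conj g x k : expgz (g * x * g^-1)%g k = (g * expgz x k * g^-1)%g.
Proof.
elim/int_rect: k => [|k IHk|k IHk]; first by rewrite !expgz0 mulg1 mulgV.
  by rewrite -(add1n k) PoszD !expgz1D IHk !mulgA mulgVK.
rewrite -(add1n k) PoszD opprD !expgzD IHk !expgzN !expgz1.
by rewrite !invgM invgK !mulgA mulgVK.
Qed.

End IntPower.

Section Multiplicative.
Variables (G H : groupType) (f : {multiplicative G -> H}).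

Lemma gmulf1g : f 1%g = 1%g.
Proof. by apply: (mulgI (f 1%g)); rewrite -gmulfM !mulg1. Qed.

Lemma gmulfVg x : f x^-1%g = (f x)^-1%g.
Proof. by apply: (mulgI (f x)); rewrite -gmulfM !mulgV gmulf1g. Qed.

Lemma gmulf_expgn x (n : nat) : f (x ^+ n)%g = (f x ^+ n)%g.
Proof. by elim: n => [|n IHn]; rewrite ?gmulf1g// !expgS gmulfM IHn. Qed.

Lemma gmulf_expgz x k : f (expgz x k) = expgz (f x) k.
Proof. by case: k => n /=; rewrite ?gmulfVg gmulf_expgn. Qed.

End Multiplicative.

(** * Actions of presented groups defined on letters *)

Section WordAction.
Variables (X : choiceType) (rel : word X -> word X -> Prop).
Variables (S : Type) (inv : S -> Prop) (act : X * bool -> S -> S).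

Definition wact (w : word X) (s : S) : S := foldr act s w.

Hypothesis act_inv : forall l s, inv s -> inv (act l s).
Hypothesis actK : forall x b s, inv s -> act (x, b) (act (x, ~~ b) s) = s.
Hypothesis act_rel : forall u v s, rel u v -> inv s -> wact u s = wact v s.

Lemma wact_cat u v s : wact (u ++ v) s = wact u (wact v s).
Proof. exact: foldr_cat. Qed.

Lemma wact_inv w s : inv s -> inv (wact w s).
Proof. by move=> s_inv; elim: w => //= l w; exact: act_inv. Qed.

(** Induction on the congruence. The invariant [inv] is carried along because a letter and its
    inverse need only cancel on good states, such as reduced normal forms. *)
Lemma wact_word_eq u v s : word_eq rel u v -> inv s -> wact u s = wact v s.
Proof.
move=> uv; elim: uv s => {u v} [u|u v _ IH|u v w _ IH1 _ IH2|
    u u' v v' _ IHu _ IHv|x b|u v ruv] s s_inv //.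
- by rewrite IH.
- by rewrite IH1 ?IH2.
- by rewrite !wact_cat IHv ?IHu//; exact: wact_inv.
- exact: actK.
- exact: act_rel.
Qed.

Definition pact (a : presented rel) (s : S) : S := wact (pword a) s.

Lemma pact_pclass w s : inv s -> pact (pclass rel w) s = wact w s.
Proof. by apply: wact_word_eq; exact: pword_pclass. Qed.

Lemma pact_inv a s : inv s -> inv (pact a s).
Proof. exact: wact_inv. Qed.

Lemma pact1 s : inv s -> pact 1%g s = s.
Proof. by move=> s_inv; rewrite (pact_pclass [::]). Qed.

Lemma pactM a b s : inv s -> pact (a * b)%g s = pact a (pact b s).
Proof. by move=> s_inv; rewrite [LHS]pact_pclass// wact_cat. Qed.

End WordAction.

Section PresentedTheory.
Variables (X : choiceType) (rel : word X -> word X -> Prop).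

Definition pgen (x : X) : presented rel := pclass rel (gen x).

Lemma pclass_cat u v : pclass rel (u ++ v) = (pclass rel u * pclass rel v)%g.
Proof. exact: pclassM. Qed.

Lemma pclass_geninv x : pclass rel (geninv x) = (pgen x)^-1%g.
Proof.
apply: (mulgI (pgen x)); rewrite mulgV -pclass_cat.
by apply/pclassP; exact: word_eq_cancel.
Qed.

Lemma pclass_genexp x k : pclass rel (genexp x k) = expgz (pgen x) k.
Proof.
have pos n : pclass rel (nseq n (x, false)) = (pgen x ^+ n)%g.
  elim: n => [|n IHn]; first by rewrite expg0.
  by rewrite (pclass_cat (gen x)) IHn expgS.
have neg n : pclass rel (nseq n (x, true)) = (pgen x ^- n)%g.
  elim: n => [|n IHn]; first by rewrite expg0 invg1.
  by rewrite (pclass_cat (geninv x)) IHn expgSr invgM pclass_geninv.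
by case: k => n; [exact: pos|exact: neg].
Qed.

Lemma presented_ind (P : presented rel -> Prop) : P 1%g ->
  (forall x g, P g -> P (pgen x * g)%g) ->
  (forall x g, P g -> P ((pgen x)^-1 * g)%g) -> forall g, P g.
Proof.
move=> P1 Pg PV g; rewrite -[g]pwordK.
elim: (pword g) => [|[x b] w IHw]; first exact: P1.
rewrite (pclass_cat [:: (x, b)]); case: b; last exact: Pg.
by rewrite -/(geninv x) pclass_geninv; exact: PV.
Qed.

(** The universal property: words act on [H] by left multiplication, which commutes with right
    multiplication, and the homomorphism is the orbit map of 1. *)
Lemma presented_lift (H : groupType) (f : X -> H) :
  (forall u v, rel u v ->
     forall h, wact (fun l h => (if l.2 then (f l.1)^-1 else f l.1) * h)%g u h =
       wact (fun l h => (if l.2 then (f l.1)^-1 else f l.1) * h)%g v h) ->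
  exists phi : {multiplicative presented rel -> H},
    forall x, phi (pgen x) = f x.
Proof.
set act := (fun l h => _) => frel.
have actM w h k : wact act w (h * k)%g = (wact act w h * k)%g.
  by elim: w => //= l w ->; rewrite /act mulgA.
have actK x b (h : H) : True -> act (x, b) (act (x, ~~ b) h) = h.
  by case: b => _ /=; rewrite /act /= ?mulKg ?mulVKg.
have act_rel u v (h : H) : rel u v -> True -> wact act u h = wact act v h.
  by move=> uv _; exact: frel.
pose F (a : presented rel) : H := pact act a 1%g.
have FM : {morph F : a b / (a * b)%g}.
  move=> a b; rewrite /F (@pactM _ _ _ (fun=> True) act)//.
  by rewrite -{1}[pact act b 1%g]mul1g /pact actM.
pose phi : {multiplicative presented rel -> H} :=
  HB.pack F (isMultiplicative.Build _ _ F FM).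
exists phi => x; rewrite -[LHS]/(pact act (pclass rel (gen x)) 1%g).
by rewrite (@pact_pclass _ _ _ (fun=> True) act)//= /act /= mulg1.
Qed.

End PresentedTheory.

(** * Length functions and ends *)

Lemma eventually_seq (T : eqType) (s : seq T) (P : T -> nat -> Prop) :
  (forall x, x \in s -> exists n0, forall n, (n0 <= n)%N -> P x n) ->
  exists n0, forall n, (n0 <= n)%N -> forall x, x \in s -> P x n.
Proof.
elim: s => [|x s IHs] H; first by exists 0%N.
have [|n1 H1] := IHs; first by move=> y ys; apply: H; rewrite inE ys orbT.
have [|n2 H2] := H x; first by rewrite inE eqxx.
exists (maxn n1 n2) => n; rewrite geq_max => /andP[h1 h2] y.
by rewrite inE => /predU1P[->|]; [exact: H2|exact: H1].
Qed.

(* The hierarchy of group structures gives convertible but syntactically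
   distinct forms of the same product, which [lia] does not identify. *)
Ltac lia_upto L c :=
  intros;
  repeat match goal with
  | H : context [L _] |- _ => revert H
  | H : context [c _ _] |- _ => revert H
  end;
  repeat (match goal with |- context [c ?x ?y] =>
    let n := fresh "n" in
    set (n := c x y);
    repeat match goal with |- context [c ?x' ?y'] =>
      unify x x'; unify y y'; change (c x' y') with n end;
    clearbody n end);
  repeat (match goal with |- context [L ?x] =>
    let n := fresh "n" in
    set (n := L x);
    repeat match goal with |- context [L ?x'] =>
      unify x x'; change (L x') with n end;
    clearbody n end);
  clear; lia.

Section Lyndon.
Variables (G : groupType) (L : G -> nat) (c : G -> G -> nat).
Hypothesis L1 : L 1%g = 0%N.
Hypothesis Lc : forall g h : G, (L (g^-1 * h)%g + 2 * c g h = L g + L h)%N.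
Hypothesis c_ultra : forall g h k, (minn (c g h) (c h k) <= c g k)%N.
Implicit Types (f g h x y : G) (w : nat -> G).

Lemma lenV g : L g^-1%g = L g.
Proof.
have := Lc g 1%g; have := Lc g^-1%g 1%g.
by rewrite !mulg1 invgK L1; lia_upto L c.
Qed.

Lemma gromovC g h : c g h = c h g.
Proof.
have E : L (h^-1 * g)%g = L (g^-1 * h)%g by rewrite -lenV invgM invgK.
by have := Lc g h; have := Lc h g; rewrite E; lia_upto L c.
Qed.

Lemma lenM g h : (L (g * h)%g <= L g + L h)%N.
Proof. by have := Lc g^-1%g h; rewrite invgK lenV; lia_upto L c. Qed.

Lemma gromov_lel g h : (c g h <= L g)%N.
Proof.
have := Lc g h; have := lenM g (g^-1 * h)%g; rewrite mulVKg; lia_upto L c.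
Qed.

Lemma gromov_translate g x y : (c x y <= c (g * x)%g (g * y)%g + L g)%N.
Proof.
have := Lc (g * x)%g (g * y)%g; have := Lc x y.
have := lenM g^-1%g (g * x)%g; have := lenM g^-1%g (g * y)%g.
rewrite !mulKg lenV invgM -mulgA mulKg; lia_upto L c.
Qed.

Lemma gromov_ge g h x k : (k <= c g h -> k <= c h x -> k <= c g x)%N.
Proof. by move=> gh hx; apply: leq_trans (c_ultra g h x); rewrite leq_min gh. Qed.

(** The hypothesis says that the path from g^-1 through the base vertex to g does not backtrack, so
    the base vertex lies on the axis. The induction needs two consecutive lengths: they give
    [c g (g ^+ n.+1) = L g > 0], and [c_ultra] then makes [c g^-1 (g ^+ n.+1)] vanish. *)
Lemma len_expg g (n : nat) : c g^-1%g g = 0%N -> L (g ^+ n)%g = (n * L g)%N.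
Proof.
move=> cg; have [l0|l0] := posnP (L g).
  rewrite l0 muln0; elim: n => [|n IHn]; first by rewrite expg0 L1.
  by have := lenM g (g ^+ n)%g; rewrite expgS; lia_upto L c.
suff : L (g ^+ n)%g = (n * L g)%N /\ L (g ^+ n.+1)%g = (n.+1 * L g)%N by case.
elim: n => [|n [IH1 IH2]]; first by rewrite expg0 expg1 L1 mul1n.
split=> //; have := Lc g (g ^+ n.+1)%g; rewrite expgS mulKg -expgS IH1 IH2 => cgn.
have := Lc g^-1%g (g ^+ n.+1)%g; rewrite invgK -expgS lenV IH2.
have : (minn (c g^-1%g (g ^+ n.+1)%g) (c (g ^+ n.+1)%g g) <= 0)%N.
  by rewrite -cg c_ultra.
by rewrite (gromovC _ g); lia_upto L c.
Qed.

(** For rays: convergence to the same end of the tree. *)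
Definition conv w w' : Prop :=
  forall K : nat, exists n0, forall n, (n0 <= n)%N -> (K <= c (w n) (w' n))%N.

Definition ray w : Prop :=
  forall K : nat, exists n0, forall m n, (n0 <= m)%N -> (n0 <= n)%N ->
    (K <= c (w m) (w n))%N.

(** A Busemann cocycle. If [f] fixes the end of the ray [w], then [z] is its signed translation
    towards that end. *)
Definition shift f w (z : int) : Prop :=
  exists n0, forall n, (n0 <= n)%N ->
    (L (f * w n)%g)%:Z = (L (w n))%:Z + z.

Lemma conv_sym w w' : conv w w' -> conv w' w.
Proof.
by move=> ww' K; have [n0 H] := ww' K; exists n0 => n /H; rewrite gromovC.
Qed.

Lemma conv_trans w1 w2 w3 : conv w1 w2 -> conv w2 w3 -> conv w1 w3.
Proof.
move=> h1 h2 K; have [n1 H1] := h1 K; have [n2 H2] := h2 K.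
exists (maxn n1 n2) => n; rewrite geq_max => /andP[/H1 h /H2]; exact: gromov_ge.
Qed.

Lemma conv_translate g w w' :
  conv w w' -> conv (fun n => g * w n)%g (fun n => g * w' n)%g.
Proof.
move=> ww' K; have [n0 H] := ww' (K + L g)%N; exists n0 => n /H.
by have := gromov_translate g (w n) (w' n); lia_upto L c.
Qed.

Lemma conv_translateE g w w' :
  conv (fun n => g * w n)%g (fun n => g * w' n)%g -> conv w w'.
Proof.
move=> /(conv_translate g^-1%g) H K; have [n0 H0] := H K.
by exists n0 => n /H0; rewrite !mulKg.
Qed.

Lemma ray_translate g w : ray w -> ray (fun n => g * w n)%g.
Proof.
move=> rw K; have [n0 H] := rw (K + L g)%N; exists n0 => m n m0 /(H _ _ m0).
by have := gromov_translate g (w m) (w n); lia_upto L c.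
Qed.

(** Failure of convergence only bounds the product at infinitely many indices; since both sequences
    are rays, the ultrametric inequality spreads the bound to all large ones. *)
Lemma not_convP w w' : ray w -> ray w' -> ~ conv w w' ->
  exists K n0 : nat, forall n, (n0 <= n)%N -> (c (w n) (w' n) < K)%N.
Proof.
move=> rw rw' nww'.
have [K HK] : exists K, forall n0, exists2 n, (n0 <= n)%N & (c (w n) (w' n) < K)%N.
  apply: contrapT => H; apply: nww' => K; apply: contrapT => H'.
  apply: H; exists K => n0; apply: contrapT => H; apply: H'; exists n0 => n n0n.
  by rewrite leqNgt; apply/negP => lt; apply: H; exists n.
have [n1 H1] := rw K; have [n2 H2] := rw' K.
have [n nn cn] := HK (maxn n1 n2).
exists K, (maxn n1 n2) => m mm; rewrite ltnNge; apply/negP => Km.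
move: nn mm; rewrite !geq_max => /andP[a1 a2] /andP[b1 b2].
have := gromov_ge (gromov_ge (H1 n m a1 b1) Km) (H2 m n b2 a2).
by rewrite leqNgt cn.
Qed.

(** Once [w m] and [w n] agree beyond length [L g], which bounds [c g _], the ultrametric inequality
    forces equality. *)
Lemma gromov_eventually g w : ray w ->
  exists n0, forall m n, (n0 <= m)%N -> (n0 <= n)%N -> c g (w m) = c g (w n).
Proof.
move=> rw; have [n0 H] := rw (L g).+1; exists n0 => m n hm hn.
have := H _ _ hm hn; have := H _ _ hn hm.
have := c_ultra g (w m) (w n); have := c_ultra g (w n) (w m).
by have := gromov_lel g (w m); have := gromov_lel g (w n); lia_upto L c.
Qed.

Lemma shift_exists f w : ray w -> exists z, shift f w z.
Proof.
move=> rw; have [n0 H] := gromov_eventually f^-1%g rw.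
exists ((L f)%:Z - (2 * c f^-1%g (w n0))%N%:Z), n0 => n h.
have := Lc f^-1%g (w n); rewrite invgK lenV (H _ _ h (leqnn _)); lia_upto L c.
Qed.

Lemma shift_uniq f w z z' : shift f w z -> shift f w z' -> z = z'.
Proof.
move=> [n1 H1] [n2 H2]; have := H1 (maxn n1 n2) (leq_maxl _ _).
by have := H2 (maxn n1 n2) (leq_maxr _ _); lia_upto L c.
Qed.

(** Eventually [w n] and [f * w n] agree beyond length [L g], so [g] changes both lengths by the
    same amount. *)
Lemma shiftM f g w z z' : ray w -> conv (fun n => f * w n)%g w ->
  shift g w z -> shift f w z' -> shift (g * f)%g w (z + z').
Proof.
move=> rw fw [n1 H1] [n2 H2]; have [n3 H3] := fw (L g).+1.
exists (maxn n1 (maxn n2 n3)) => n; rewrite !geq_max.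
move=> /andP[/H1 h1 /andP[/H2 h2 /H3 h3]].
have := Lc g^-1%g (w n); have := Lc g^-1%g (f * w n)%g.
rewrite invgK lenV mulgA.
have := c_ultra g^-1%g (w n) (f * w n)%g.
have := c_ultra g^-1%g (f * w n)%g (w n); rewrite (gromovC (w n)).
have := gromov_lel g^-1%g (w n); have := gromov_lel g^-1%g (f * w n)%g; rewrite lenV.
lia_upto L c.
Qed.

(* An isometry fixing two ends translates along the line joining them. *)
Lemma shift_opp f w w' z z' : ray w -> ray w' ->
  conv (fun n => f * w n)%g w -> conv (fun n => f * w' n)%g w' ->
  ~ conv w w' -> shift f w z -> shift f w' z' -> z + z' = 0.
Proof.
move=> rw rw' fw fw' nww' [n1 H1] [n2 H2].
have [K [n0 H0]] := not_convP rw rw' nww'.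
have [n3 H3] := fw K; have [n4 H4] := fw' K.
pose n := maxn n0 (maxn (maxn n1 n2) (maxn n3 n4)).
have {}H0 := H0 n (leq_maxl _ _).
have {}H1 : (L (f * w n)%g)%:Z = (L (w n))%:Z + z by apply: H1; lia_upto L c.
have {}H2 : (L (f * w' n)%g)%:Z = (L (w' n))%:Z + z' by apply: H2; lia_upto L c.
have {}H3 : (K <= c (f * w n)%g (w n))%N by apply: H3; lia_upto L c.
have {}H4 : (K <= c (f * w' n)%g (w' n))%N by apply: H4; lia_upto L c.
have := Lc (w n) (w' n); have := Lc (f * w n)%g (f * w' n)%g.
rewrite invgM -mulgA mulKg.
have := c_ultra (w n) (f * w n)%g (w' n).
have := c_ultra (f * w n)%g (f * w' n)%g (w' n).
have := c_ultra (f * w n)%g (w n) (f * w' n)%g.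
have := c_ultra (w n) (w' n) (f * w' n)%g.
rewrite (gromovC (w n) (f * w n)%g) (gromovC (w' n) (f * w' n)%g); lia_upto L c.
Qed.

(** * Rays along the axis of a hyperbolic element *)

Section Axis.
Variables (t : G) (l : nat).
Hypothesis l0 : (0 < l)%N.
Hypothesis Lt : forall n : nat, L (t ^+ n)%g = (n * l)%N.

Lemma gromov_expg (m n : nat) : (m <= n)%N -> c (t ^+ m)%g (t ^+ n)%g = (m * l)%N.
Proof.
move=> mn; rewrite -(subnKC mn); move: (n - m)%N => k.
have := Lc (t ^+ m)%g (t ^+ (m + k))%g.
by rewrite {1}expgnDr mulKg !Lt mulnDl; lia_upto L c.
Qed.

Lemma ray_expg : ray (fun n => t ^+ n)%g.
Proof.
move=> K; exists K => m n hm hn.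
wlog mn : m n hm hn / (m <= n)%N => [H|].
  have [/H|/ltnW /H] := leqP m n; first exact.
  by rewrite gromovC; exact.
rewrite gromov_expg//; apply: (leq_trans hm); exact: leq_pmulr.
Qed.

Lemma ray_axis g : ray (fun n => g * t ^+ n)%g.
Proof. exact: ray_translate ray_expg. Qed.

Lemma shift_expg (k : nat) : shift (t ^+ k)%g (fun n => t ^+ n)%g (k * l)%N%:Z.
Proof. by exists 0%N => n _; rewrite -expgnDr !Lt; lia. Qed.

Lemma conv_expg (k : nat) :
  conv (fun n => t ^+ k * t ^+ n)%g (fun n => t ^+ n)%g.
Proof.
move=> K; exists K => n hn.
rewrite -expgnDr gromovC gromov_expg ?leq_addl//; apply: (leq_trans hn); exact: leq_pmulr.
Qed.

(** The vertex of [g t^n] and its image under [f] are at the same distance from the base vertex, and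
    far along the ray both lie on a common geodesic from it; hence they coincide. *)
Lemma conv_shift0 f g : conv (fun n => f * (g * t ^+ n))%g (fun n => g * t ^+ n)%g ->
  shift f (fun n => g * t ^+ n)%g 0 ->
  exists n0, forall n, (n0 <= n)%N ->
    L ((g * t ^+ n)^-1 * (f * (g * t ^+ n)))%g = 0%N.
Proof.
move=> fg [n2 H2]; have [z [n1 H1]] := shift_exists g ray_expg.
exists (maxn n1 n2) => n; rewrite geq_max => /andP[hn1 hn2].
have [n3 H3] := fg (L (g * t ^+ n)%g).
pose m := maxn n3 n; have mn : (n <= m)%N by rewrite leq_maxr.
have {}H3 : (L (g * t ^+ n) <= c (f * (g * t ^+ m)) (g * t ^+ m))%g%N.
  by apply: H3; rewrite leq_maxl.
have tmn : (t ^+ m = t ^+ n * t ^+ (m - n))%g by rewrite -expgnDr subnKC.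
have a1 := H1 n hn1; have a2 := H1 m (leq_trans hn1 mn).
have b1 := H2 n hn2; have b2 := H2 m (leq_trans hn2 mn).
have mnl : (m * l = n * l + (m - n) * l)%N by rewrite -mulnDl subnKC.
have Ed h : ((h * t ^+ n)^-1 * (h * t ^+ m) = t ^+ (m - n))%g.
  by rewrite tmn (mulgA h) mulKg.
have g1 := Lc (g * t ^+ n)%g (g * t ^+ m)%g.
rewrite Ed Lt in g1; rewrite !Lt in a1 a2.
have g2 := Lc (f * (g * t ^+ n))%g (f * (g * t ^+ m))%g.
rewrite !(mulgA f) Ed Lt -!(mulgA f) in g2.
(* For large [n] the vertex of [g t^n] lies between the base vertex and that of [g t^m]; [c2'] is
   the same for the images under [f]. *)
have c1' : c (g * t ^+ n)%g (g * t ^+ m)%g = L (g * t ^+ n)%g.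
  move: g1 a1 a2; rewrite mnl PoszD; move: ((m - n) * l)%N => q.
  clear; lia_upto L c.
have c2' : c (f * (g * t ^+ n))%g (f * (g * t ^+ m))%g = L (g * t ^+ n)%g.
  move: g2 a1 a2 b1 b2; rewrite mnl PoszD; move: ((m - n) * l)%N => q.
  clear; lia_upto L c.
have := Lc (g * t ^+ n)%g (f * (g * t ^+ n))%g.
have d1 : (L (g * t ^+ n) <= c (g * t ^+ n) (f * (g * t ^+ m)))%g%N.
  by apply: (@gromov_ge _ (g * t ^+ m)%g); rewrite ?c1'// gromovC.
have d2 : (L (g * t ^+ n) <= c (g * t ^+ n) (f * (g * t ^+ n)))%g%N.
  by apply: (gromov_ge d1); rewrite gromovC c2'.
by move: b1 d2; clear; lia_upto L c.
Qed.

End Axis.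

(** * Dynamics of a hyperbolic element on the ends *)

Section Dynamics.
Variables (t b : G) (l : nat).
Hypothesis l0 : (0 < l)%N.
Hypothesis Lt : forall n : nat, L (t ^+ n)%g = (n * l)%N.
Hypothesis fix_axis : forall f,
  (forall n : nat, L ((t ^+ n)^-1 * (f * t ^+ n))%g = 0%N) -> f = 1%g.
Hypothesis b_order : forall k : nat, (0 < k)%N -> (b ^+ k)%g <> 1%g.
Hypothesis Lb : forall k : nat, L (b ^+ k)%g = 0%N.

Lemma len_expgV (n : nat) : L (t^-1 ^+ n)%g = (n * l)%N.
Proof. by rewrite expVgn lenV Lt. Qed.

(** Conjugating by a far vertex of the ray turns the fixed tail into the whole half-axis of
    [fix_axis]. *)
Lemma fix_end_shift0 f g :
  conv (fun n => f * (g * t ^+ n))%g (fun n => g * t ^+ n)%g ->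
  shift f (fun n => g * t ^+ n)%g 0 -> f = 1%g.
Proof.
move=> cf sf; have [n0 H] := conv_shift0 l0 Lt cf sf.
suff : ((g * t ^+ n0)^-1 * (f * (g * t ^+ n0)) = 1)%g.
  by move=> /(canRL (mulKg _)) /(canRL (mulgK _)); rewrite !mulg1 invgK mulgV.
apply: fix_axis => n; rewrite -(H (n0 + n)%N (leq_addr _ _)); congr L.
by rewrite expgnDr !invgM !mulgA.
Qed.

(** Otherwise [b ^+ (j - i)] would fix the end of [t]; it has shift 0 because it fixes the base
    vertex, so it would be trivial. *)
Lemma end_not_conv (i j : nat) : (i < j)%N ->
  ~ conv (fun n => b ^+ i * t ^+ n)%g (fun n => b ^+ j * t ^+ n)%g.
Proof.
move=> ij cij; apply: (b_order (k := (j - i)%N)); first by rewrite subn_gt0.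
have rt := ray_expg l0 Lt.
apply: (@fix_end_shift0 _ 1%g).
  apply: conv_sym; apply: (@conv_translateE (b ^+ i)%g) => K.
  have [n0 H] := cij K; exists n0 => n /H.
  by rewrite !mul1g mulgA -expgnDr subnKC// ltnW.
exists 0%N => n _; rewrite addr0; congr Posz.
have := lenM (b ^+ (j - i))%g (1 * t ^+ n)%g.
have := lenM (b ^+ (j - i))^-1%g (b ^+ (j - i) * (1 * t ^+ n))%g.
by rewrite mulKg lenV Lb; lia_upto L c.
Qed.

Lemma unfixed_end (F : seq G) : 1%g \notin F -> exists g, forall f, f \in F ->
  ~ conv (fun n => f * (g * t ^+ n))%g (fun n => g * t ^+ n)%g.
Proof.
move=> F1.
have [|n0 H] := @eventually_seq _ F (fun f i =>
  ~ conv (fun n => f * (b ^+ i * t ^+ n))%g (fun n => b ^+ i * t ^+ n)%g).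
  move=> f fF; apply: contrapT => H.
  have {}H n0 : exists2 n, (n0 <= n)%N &
      conv (fun m => f * (b ^+ n * t ^+ m))%g (fun m => b ^+ n * t ^+ m)%g.
    apply: contrapT => H'; apply: H; exists n0 => n hn cn.
    by apply: H'; exists n.
  have [n1 _ c1'] := H 0%N; have [n2 h2 c2'] := H n1.+1.
  have [n3 h3 c3'] := H n2.+1.
  have rb i : ray (fun n => b ^+ i * t ^+ n)%g := ray_axis l0 Lt _.
  have [z1 s1] := shift_exists f (rb n1).
  have [z2 s2] := shift_exists f (rb n2).
  have [z3 s3] := shift_exists f (rb n3).
  have e12 := shift_opp (rb n1) (rb n2) c1' c2' (end_not_conv h2) s1 s2.
  have e23 := shift_opp (rb n2) (rb n3) c2' c3' (end_not_conv h3) s2 s3.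
  have h13 : (n1 < n3)%N by lia.
  have e13 := shift_opp (rb n1) (rb n3) c1' c3' (end_not_conv h13) s1 s3.
  (* Three numbers that are pairwise opposite vanish. *)
  have z10 : z1 = 0 by lia.
  by rewrite z10 in s1; rewrite -(fix_end_shift0 c1' s1) fF in F1.
by exists (b ^+ n0)%g => f fF; exact: H.
Qed.

Lemma conv_expg_inv (k : nat) :
  conv (fun n => t ^+ k * t^-1 ^+ n)%g (fun n => t^-1 ^+ n)%g.
Proof.
have [n0 H] : exists n0, forall n, (n0 <= n)%N ->
    (t ^+ k * t^-1 ^+ n = t^-1 ^+ (n - k))%g.
  exists k => n kn; rewrite -{1}(subnKC kn) expgnDr expVgn.
  by rewrite mulVKg.
have rtV := ray_expg l0 len_expgV.
move=> K; have [n1 H1] := rtV K; exists (maxn n0 (n1 + k)) => n; rewrite geq_max.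
move=> /andP[/H -> hn]; apply: H1; lia.
Qed.

Lemma shift_expg_inv (k : nat) :
  shift (t ^+ k)%g (fun n => t^-1 ^+ n)%g (- (k * l)%N%:Z).
Proof.
exists k => n kn; have -> : (t ^+ k * t^-1 ^+ n = t^-1 ^+ (n - k))%g.
  by rewrite -{1}(subnKC kn) expgnDr expVgn mulVKg.
rewrite !len_expgV mulnBl; have : (k * l <= n * l)%N by rewrite leq_mul2r kn orbT.
lia.
Qed.

(** If the orbit of the repelling end contains the attracting one, the powers of [b] separate
    translates. Otherwise the powers of [t] do: a power fixing a third end would have there a shift
    opposite to both its shifts k l and - k l. *)
Lemma many_ends (s : G) :
  ~ conv (fun n => s * t^-1 ^+ n)%g (fun n => t^-1 ^+ n)%g ->
  exists h : nat -> G, forall i j, (i < j)%N ->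
  ~ conv (fun n => h i * t^-1 ^+ n)%g (fun n => h j * t^-1 ^+ n)%g.
Proof.
move=> ns.
have [[s' cs]|nE] := pselect (exists s',
    conv (fun n => s' * t^-1 ^+ n)%g (fun n => t ^+ n)%g).
  exists (fun j => b ^+ j * s')%g => i j ij cij; apply: (end_not_conv ij).
  have cb k : conv (fun n => b ^+ k * s' * t^-1 ^+ n)%g (fun n => b ^+ k * t ^+ n)%g.
    move=> K; have [n0 H] := conv_translate (b ^+ k)%g cs K.
    by exists n0 => n /H; rewrite mulgA.
  exact: conv_trans (conv_sym (cb i)) (conv_trans cij (cb j)).
exists (fun j => t ^+ j * s)%g => i j ij cij.
pose k := (j - i)%N; have k0 : (0 < k)%N by rewrite subn_gt0.
pose f := (t ^+ k)%g.
have r1 := ray_expg l0 Lt; have r2 := ray_expg l0 len_expgV.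
have r3 : ray (fun n => s * t^-1 ^+ n)%g := ray_axis l0 len_expgV s.
have c3' : conv (fun n => f * (s * t^-1 ^+ n))%g (fun n => s * t^-1 ^+ n)%g.
  apply: conv_sym; apply: (@conv_translateE (t ^+ i)%g) => K.
  have [n0 H] := cij K; exists n0 => n /H.
  by rewrite /f !mulgA -expgnDr subnKC// ltnW.
have [z sz] := shift_exists f r3.
have n13 : ~ conv (fun n => t ^+ n)%g (fun n => s * t^-1 ^+ n)%g.
  by move=> /conv_sym H; apply: nE; exists s.
have e1 := shift_opp r1 r3 (conv_expg l0 Lt k) c3' n13 (shift_expg l0 Lt k) sz.
have e2 := shift_opp r3 r2 c3' (conv_expg_inv k) ns sz (shift_expg_inv k).
have : (0 < k * l)%N by rewrite muln_gt0 k0.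
by move: e1 e2; lia.
Qed.

(** [C] is a half-tree around an end fixed by no element of [F]. After [g0^-1], the power [t ^ -M']
    pushes its complement close to the repelling end, and the [h i] carry this to distinct ends. *)
Lemma lyndon_powers (s : G) :
  ~ conv (fun n => s * t^-1 ^+ n)%g (fun n => t^-1 ^+ n)%g -> powers_property G.
Proof.
move=> ns F N F1; have [h hN] := many_ends ns.
have [g0 gF] := unfixed_end F1.
have rg : ray (fun n => g0 * t ^+ n)%g := ray_axis l0 Lt g0.
(* The depth [m * l] makes the half-tree disjoint from its images under [F]; the terms [L g0] and
   [L f] absorb changes of base point. *)
have [|m Hm] := @eventually_seq _ F (fun f n =>
  (c (f * (g0 * t ^+ n)) (g0 * t ^+ n) + L g0 + L f < n * l)%N)%g.
  move=> f fF; have [K [n0 H]] := not_convP (ray_translate f rg) rg (gF f fF).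
  exists (maxn n0 (K + L g0 + L f)) => n; rewrite geq_max => /andP[/H cn hn].
  by apply: (@leq_trans n); [move: cn hn; lia_upto L c|exact: leq_pmulr].
have {}Hm := Hm m (leqnn m).
have [|M HM] := @eventually_seq _ (enum {: 'I_N * 'I_N}) (fun p M => (p.1 < p.2)%N ->
  (c (h p.1 * t^-1 ^+ M) (h p.2 * t^-1 ^+ M) + L (h p.1) + L (h p.2) + m * l
   < M * l)%N)%g.
  move=> [i j] _ /=; have [ij|_] := ltnP i j; last by exists 0%N.
  have [K [n0 H]] := not_convP (ray_axis l0 len_expgV _) (ray_axis l0 len_expgV _) (hN i j ij).
  exists (maxn n0 (K + L (h i) + L (h j) + m * l)) => n; rewrite geq_max.
  move=> /andP[/H cn hn] _.
  apply: (@leq_trans n); last exact: leq_pmulr.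
  by move: cn hn; move: (m * l)%N; lia_upto L c.
pose M' := maxn M m; have {}HM := HM M' (leq_maxl _ _).
exists [set x | (m * l <= c (g0^-1 * x) (t ^+ m))%g%N].
exists (fun i => h i * (t^-1 ^+ M' * g0^-1))%g; split.
  move=> f x fF /= Cx Cfx; have := Hm f fF.
  have a1 := gromov_translate g0 (g0^-1 * x)%g (t ^+ m)%g.
  have a2 := gromov_translate g0 (g0^-1 * (f * x))%g (t ^+ m)%g.
  have a3 := gromov_translate f x (g0 * t ^+ m)%g.
  have a4 := c_ultra (f * (g0 * t ^+ m))%g (f * x)%g (g0 * t ^+ m)%g.
  rewrite !mulVKg in a1 a2; rewrite (gromovC (f * (g0 * t ^+ m))%g (f * x)%g) in a4.
  by move: a1 a2 a3 a4 Cx Cfx; clear; move: (m * l)%N; lia_upto L c.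
move=> i j x; wlog ij : i j / (i < j)%N => [H ij|_].
  have [/H|ji|/val_inj ijE] := ltngtP i j; first exact.
    by have [|h1|h1] := H j i ji; [rewrite eq_sym|right|left].
  by rewrite ijE eqxx in ij.
apply: contrapT => /not_orP[/= ni nj].
have := HM (i, j); rewrite mem_enum => /(_ isT ij) /=.
(* A point outside the translate of [C] shares with [h k t^-M'] all of the length M' l except at
   most L (h k) + m l. *)
have far k : ~ (m * l <= c (g0^-1 * ((h k * (t^-1 ^+ M' * g0^-1))^-1 * x))
                 (t ^+ m))%g%N ->
    (M' * l <= c x (h k * t^-1 ^+ M')%g + L (h k) + m * l)%N.
  move=> /negP; rewrite -ltnNge !invgM invgK -!mulgA mulKg expVgn invgK.
  set y := ((h k)^-1 * x)%g; set u := (t ^+ M' * y)%g => lt.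
  have mM : (m <= M')%N by rewrite leq_maxr.
  have a1 := c_ultra u (t ^+ M')%g (t ^+ m)%g.
  rewrite (gromovC (t ^+ M')%g) (gromov_expg Lt mM) in a1.
  have a2 := Lc y (t ^- M')%g.
  have a3 := Lc (t ^+ M')%g u; rewrite mulKg in a3.
  have a4 := gromov_translate (h k) y (t ^- M')%g; rewrite mulVKg in a4.
  have a5 : L (y^-1 * t ^- M')%g = L u by rewrite -invgM lenV.
  move: a1 a2 a3 a4 lt; rewrite a5 lenV !Lt (gromovC (t ^+ M')%g).
  clear; move: (m * l)%N (M' * l)%N; lia_upto L c.
have := far i ni; have := far j nj.
have := c_ultra (h i * t^-1 ^+ M')%g x (h j * t^-1 ^+ M')%g.
rewrite (gromovC _ x); clear; move: (m * l)%N (M' * l)%N; lia_upto L c.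
Qed.

End Dynamics.
End Lyndon.

(** * Groups fixing an end *)

Lemma isomorphic_of_bij (G H : groupType) (phi : {multiplicative H -> G}) :
  injective phi -> (forall g, exists h, phi h = g) -> isomorphic G H.
Proof.
move=> phiI /choice[psi psiK].
have psiM : {morph psi : x y / (x * y)%g}.
  by move=> x y; apply: phiI; rewrite gmulfM !psiK.
exists (HB.pack_for {multiplicative G -> H} psi (isMultiplicative.Build _ _ psi psiM)).
by exists phi => // h; apply: phiI; rewrite psiK.
Qed.

Lemma wact_mul_genexp (X : choiceType) (H : groupType) (f : X -> H) x k h :
  wact (fun l h => (if l.2 then (f l.1)^-1 else f l.1) * h)%g (genexp x k) h =
  (expgz (f x) k * h)%g.
Proof.
have neg n : wact (fun l h => (if l.2 then (f l.1)^-1 else f l.1) * h)%g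
    (nseq n (x, true)) h = (f x ^- n * h)%g.
  elim: n => [|n IHn]; first by rewrite expg0 invg1 mul1g.
  by rewrite /= IHn mulgA expgSr invgM.
case: k => n; last exact: neg.
elim: n => [|n IHn]; first by rewrite expgz0 mul1g.
by rewrite /= in IHn *; rewrite IHn mulgA -expgS.
Qed.

(** * Solvable Baumslag-Solitar groups *)

Section BS1NormalForm.
Variable M : int.
Notation T := (pgen (BS1_rel M) BS_t).
Notation A := (pgen (BS1_rel M) BS_a).

Lemma BS1_conj : (T * A * T^-1 = expgz A M)%g.
Proof.
have /(pclassP (BS1_rel M)) := word_eq_rel (BS1_rel_conj M).
by rewrite !pclass_cat pclass_geninv pclass_genexp mulgA.
Qed.

Lemma BS1_conj_expg (n : nat) : (T ^+ n * A = expgz A (M ^+ n) * T ^+ n)%g.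
Proof.
elim: n => [|n IHn]; first by rewrite expg0 mulg1 mul1g expr0 expgz1.
rewrite expgS -mulgA IHn exprS expgzM -BS1_conj expgz_conj !mulgA.
by rewrite mulgVK.
Qed.

(** These products are stable under left multiplication by generators: [a] passes [t^-n] as a^(M^n),
    and [t] either cancels or passes a^i as a^(M i). *)
Lemma BS1_normal_form (x : BS1 M) : exists (n : nat) (i q : int),
  x = (T ^- n * (expgz A i * expgz T q))%g.
Proof.
elim/presented_ind: x => [|[] x [n [i [q ->]]]|[] x [n [i [q ->]]]].
- by exists 0%N, 0, 0; rewrite expg0 invg1 !expgz0 !mulg1.
- case: n => [|n].
    exists 0%N, (M * i), (1 + q); rewrite !expg0 invg1 !mul1g expgzD expgz1.
    rewrite expgzM -BS1_conj expgz_conj !mulgA.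
    by rewrite mulgVK.
  by exists n, i, q; rewrite expgSr invgM -mulgA mulVKg.
- exists n, (M ^+ n + i), q; apply: (mulgI (T ^+ n)%g).
  by rewrite mulVKg mulgA BS1_conj_expg -mulgA mulVKg expgzD mulgA.
- by exists n.+1, i, q; rewrite expgSr invgM !mulgA.
- exists n, (- M ^+ n + i), q; apply: (mulgI (T ^+ n)%g).
  rewrite mulVKg expgzD expgzN; apply: (mulgI (expgz A (M ^+ n))).
  rewrite -(mulgA _^-1%g) mulVKg !mulgA -BS1_conj_expg.
  by rewrite mulgK mulgV mul1g.
Qed.

End BS1NormalForm.

Lemma rat_root_int (y : rat) (j : nat) (n : int) :
  (0 < j)%N -> y ^+ j = n%:~R -> exists m : int, y = m%:~R.
Proof.
move=> j0 yj; exists (numq y).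
have : (numq y ^+ j) = n * denq y ^+ j.
  apply: (@intr_inj rat); rewrite rmorphM !rmorphXn /= -yj -exprMn.
  by rewrite -{2}(divq_num_den y) divfK// intr_eq0 denq_neq0.
move=> /(congr1 absz); rewrite abszM !abszX => E.
have dj : (`|denq y| %| `|numq y| ^ j)%N.
  by rewrite E dvdn_mull// dvdn_exp.
have cj : coprime (`|numq y| ^ j) `|denq y| by rewrite coprimeXl// coprime_num_den.
have d1 : `|denq y|%N = 1%N by move/eqP: cj; move/gcdn_idPr: dj => ->.
rewrite -[LHS]divq_num_den; have -> : denq y = 1; last by rewrite divr1.
by rewrite -[LHS]gez0_abs ?d1// ltW// denq_gt0.
Qed.

Section FixedEnd.
Variables (G : groupType) (L : G -> nat) (c : G -> G -> nat).
Hypothesis L1 : L 1%g = 0%N.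
Hypothesis Lc : forall g h : G, (L (g^-1 * h)%g + 2 * c g h = L g + L h)%N.
Hypothesis c_ultra : forall g h k, (minn (c g h) (c h k) <= c g k)%N.
Implicit Types (f g h x y : G).
Variables (t b : G) (l : nat) (D : G -> rat).
Hypothesis l0 : (0 < l)%N.
Hypothesis Lt : forall n : nat, L (t ^+ n)%g = (n * l)%N.
Hypothesis Lb : forall k : int, L (expgz b k) = 0%N.
Hypothesis L_b : forall g, L g = 0%N -> exists k : int, g = expgz b k.
Hypothesis b_inj : injective (expgz b).
Hypothesis DM : {morph D : g h / (g * h)%g >-> g * h}.
Hypothesis D_neq0 : forall g, D g != 0.
Hypothesis D_conj : forall g i j,
  (g * expgz b i * g^-1)%g = expgz b j -> D g * i%:~R = j%:~R.
Hypothesis t_end : forall s,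
  conv c (fun n => s * t ^+ n)%g (fun n => t ^+ n)%g.

Let w (n : nat) : G := (t ^+ n)%g.

Lemma fixed_end_BS1 : exists M : int, M != 0 /\ isomorphic G (BS1 M).
Proof.
have rw : ray c w := ray_expg L1 Lc c_ultra l0 Lt.
(* As the whole group fixes the end of [w], the shift is a homomorphism to the integers. *)
have /choice[s sP] : forall g, exists z, shift L g w z.
  by move=> g; exact: (shift_exists L1 Lc c_ultra).
have s_uniq g z : shift L g w z -> s g = z by move=> sg; exact: (shift_uniq L1 Lc c_ultra (sP g) sg).
have sM g h : s (g * h)%g = s g + s h.
  by apply: s_uniq; apply: (shiftM L1 Lc c_ultra) => //; exact: t_end.
have s1 : s 1%g = 0 by have := sM 1%g 1%g; rewrite mulg1; lia.
have sV g : s g^-1%g = - s g by have := sM g g^-1%g; rewrite mulgV s1; lia.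
have sX g (n : int) : s (expgz g n) = n * s g.
  elim/int_rect: n => [|n IHn|n IHn]; first by rewrite expgz0 s1 mul0r.
    by rewrite -(add1n n) PoszD expgz1D sM IHn mulrDl mul1r.
  by rewrite -(add1n n) PoszD opprD expgzD sM IHn expgzN sV expgz1; lia.
have st : s t = l%:Z.
  by apply: s_uniq; have := shift_expg L1 l0 Lt 1; rewrite expg1 mul1n.
have sL g : L g = 0%N -> s g = 0.
  move=> Lg; apply: s_uniq; exists 0%N => n _; rewrite addr0; congr Posz.
  have := lenM L1 Lc c_ultra g (w n); have := lenM L1 Lc c_ultra g^-1%g (g * w n)%g.
  by rewrite mulKg (lenV L1 Lc c_ultra) Lg; lia.
have sb i : s (expgz b i) = 0 by apply: sL.
(* An element of shift 0 fixes far vertices of the ray, so a power of [t] conjugates it into the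
   powers of [b]. *)
have sK f : s f = 0 -> exists n0 : nat, forall n : nat, (n0 <= n)%N ->
    exists i, (t ^- n * f * t ^+ n)%g = expgz b i.
  move=> sf; have [||n0 H] := conv_shift0 (f := f) (g := 1%g) L1 Lc c_ultra l0 Lt.
  - by move=> K; have [n0 H] := t_end f K; exists n0 => n /H; rewrite !mul1g.
  - have [n0 H] := sP f; exists n0 => n /H; rewrite sf !mul1g; exact.
  exists n0 => n /H; rewrite !mul1g mulgA => Lf; exact: L_b Lf.
have D1 : D 1%g = 1.
  by apply: (mulfI (D_neq0 1%g)); rewrite -DM !mulr1 mulg1.
have DV g : D g^-1%g = (D g)^-1.
  by apply: (mulfI (D_neq0 g)); rewrite -DM mulgV D1 divff.
have Db i : D (expgz b i) = 1.
  apply: (mulIf (oner_neq0 _)); rewrite mul1r -[1 in LHS]/(1%:~R).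
  apply: (@D_conj _ 1 1).
  by rewrite expgz_commute mulgK.
(* One power of [t] conjugates both sides into powers of [b], whose exponents are determined by
   [D]. *)
have conj_eq g i g' i' : D g * i%:~R = D g' * i'%:~R ->
    (g * expgz b i * g^-1 = g' * expgz b i' * g'^-1)%g.
  have s0 h k : s (h * expgz b k * h^-1)%g = 0 by rewrite !sM sb sV; lia.
  move=> DE; have [n1 H1] := sK _ (s0 g i); have [n2 H2] := sK _ (s0 g' i').
  pose n := maxn n1 n2.
  have [j1 E1] := H1 n (leq_maxl _ _); have [j2 E2] := H2 n (leq_maxr _ _).
  have cE h k : (t ^- n * (h * expgz b k * h^-1) * t ^+ n =
      (t ^- n * h) * expgz b k * (t ^- n * h)^-1)%g.
    by rewrite invgM invgK !mulgA.
  have := E1; rewrite cE => /D_conj; rewrite DM -mulrA DE mulrA -DM => D1'.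
  have := E2; rewrite cE => /D_conj; rewrite D1' => /intr_inj j12.
  rewrite -j12 -E1 in E2.
  by move: E2 => /mulIg/mulgI ->.
have [u [u0 udiv]] : exists u, 0 < s u /\ forall g, (s u %| s g)%Z.
  pose P n := `[< exists2 g, s g = n.+1%:Z & True >].
  have exP : exists n, P n by exists l.-1; apply/asboolP; exists t; rewrite ?prednK.
  have [m /asboolP[u su _] min] := ex_minnP exP; exists u.
  split=> [|g]; first by rewrite su.
  apply/dvdz_mod0P; set r := (_ %% _)%Z.
  have sr : s (g * expgz u (- (s g %/ s u)%Z))%g = r.
    by rewrite sM sX {1}(divz_eq (s g) (s u)) mulNr addrAC subrr add0r.
  have r0 : 0 <= r by rewrite modz_ge0// su.
  have ru : r < s u by rewrite ltz_pmod// su.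
  case rE : r r0 => [[|k]|//] _ //.
  have /min : P k by apply/asboolP;
    exists (g * expgz u (- (s g %/ s u)%Z))%g; rewrite ?sr ?rE.
  by move: ru; rewrite rE su; lia.
(* [b] fixes the base vertex and the end, hence also the vertex of [t] on the ray between them. *)
have [N tN] : exists N : int, (t^-1 * b * t)%g = expgz b N.
  apply: L_b; have [n0 H] := t_end b l.
  have mn : (1 <= maxn n0 1)%N by rewrite leq_maxr.
  have := H (maxn n0 1) (leq_maxl _ _); set m := maxn n0 1 in mn *.
  have c1m := gromov_expg L1 Lc c_ultra Lt mn.
  have := gromov_translate L1 Lc c_ultra b (t ^+ 1)%g (t ^+ m)%g.
  have Lb1 : L b = 0%N by rewrite -[b]expgz1.
  rewrite Lb1 addn0 c1m mul1n expg1 => h1 h2.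
  have h3 := gromov_ge c_ultra h1 h2.
  rewrite (gromovC L1 Lc c_ultra) expg1 mul1n in c1m.
  have h4 : (l <= c (t ^+ m) t)%g%N by rewrite c1m.
  have h5 := gromov_ge c_ultra h3 h4.
  have := Lc t (b * t)%g; rewrite (gromovC L1 Lc c_ultra t) mulgA.
  have := lenM L1 Lc c_ultra b t; have := Lt 1; rewrite expg1 mul1n => ->.
  by move: h5; rewrite Lb1; lia_upto L c.
have DtN : D t^-1%g = N%:~R.
  have := @D_conj t^-1%g 1 N; rewrite mulr1; apply.
  by rewrite expgz1 invgK.
have /dvdzP[j tj] := udiv t.
have j0 : 0 < j by rewrite -(pmulr_lgt0 _ u0) -tj st ltz_nat.
have DK f : s f = 0 -> D f = 1.
  move=> /sK[n0 /(_ n0 (leqnn _))[i fi]].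
  have <- : (t ^+ n0 * expgz b i * t ^- n0)%g = f.
    by rewrite -fi !mulgA mulgV mul1g mulgK.
  by rewrite !DM Db DV mulr1 divff.
have DX g (n : nat) : D (g ^+ n)%g = D g ^+ n.
  by elim: n => [|n IHn]; rewrite ?expg0 ?D1// expgS exprS DM IHn.
case: j j0 tj => [j|//] j0 tj.
have Dtu : D t = D (u ^+ j)%g.
  have : D (t * expgz u (- j%:Z))%g = 1 by apply: DK; rewrite sM sX tj; lia.
  rewrite DM expgzN DV => /(canRL (mulfVK (D_neq0 _))).
  by rewrite mul1r.
(* The [j]-th power of this rational is the integer [N], since [t] and [u ^+ j] have equal shift and
   so equal modulus. *)
have [M DuM] : exists M : int, D u^-1%g = M%:~R.
  apply: (@rat_root_int _ j N) => //.
  by rewrite DV exprVn -DX -Dtu -DV.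
have M0 : M != 0.
  by apply: contraTneq (D_neq0 u^-1%g) => M0; rewrite DuM M0 negbK.
exists M; split=> //.
have uM : (u^-1 * b * u)%g = expgz b M.
  have := @conj_eq u^-1%g 1 1%g M; rewrite DuM D1 mul1r mulr1 => /(_ erefl).
  by rewrite expgz1 invgK mul1g invg1 mulg1.
have [phi phiE] : exists phi : {multiplicative BS1 M -> G},
    forall x : bool, phi (pgen (BS1_rel M) x) = if x then u^-1%g else b.
  apply: presented_lift => v1 v2 [] h.
  rewrite (wact_mul_genexp (fun x : bool => if x then u^-1%g else b)) /=.
  by rewrite -uM invgK !mulgA.
apply: (@isomorphic_of_bij _ _ phi).
  (* The shift forces [q = n] in the normal form, which leaves a conjugate of [b^i]. *)
  have ker (x : BS1 M) : phi x = 1%g -> x = 1%g.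
    have [n [i [q ->]]] := BS1_normal_form x.
    rewrite !gmulfM gmulfVg !gmulf_expgz gmulf_expgn !phiE expVgn invgK => E.
    have := congr1 s E; rewrite !sM sb s1 -expgz_nat !sX sV => qn.
    have {}qn : q = n.
      by apply: (mulIf (lt0r_neq0 u0)); move: qn; lia.
    move: E; rewrite qn expgz_nat expVgn => /(canRL (mulKg _)).
    rewrite mulg1 => /(canRL (mulgK _)); rewrite invgK mulVg -(expgz0 b).
    by move/b_inj => ->; rewrite !expgz0 mul1g mulVg.
  move=> x y xy; apply/eqP; rewrite -divg_eq1; apply/eqP; apply: ker.
  by rewrite gmulfM gmulfVg xy mulgV.
move=> g; have /dvdzP[r gr] := udiv g.
have s0 : s (g * expgz u (- r))%g = 0 by rewrite sM sX gr; lia.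
have [n0 /(_ n0 (leqnn _))[i fi]] := sK _ s0.
pose v : BS1 M := (pgen _ BS_t)^-1%g; pose a : BS1 M := pgen _ BS_a.
(* The part of shift 0 is a conjugate of [b^i] by [t ^+ n0]; by [conj_eq] the power [u ^+ (j * n0)],
   of the same modulus, conjugates it equally. *)
exists (expgz v (j * n0)%N * expgz a i * (expgz v (j * n0)%N)^-1 * expgz v r)%g.
rewrite !gmulfM gmulfVg !gmulf_expgz /v gmulfVg !phiE invgK.
have := @conj_eq (t ^+ n0)%g i (u ^+ (j * n0))%g i.
rewrite !DX Dtu DX exprM => /(_ erefl) <-.
rewrite -fi -!mulgA !mulVKg.
by rewrite -expgzD addNr expgz0 mulg1.
Qed.

End FixedEnd.

(** * Normal forms *)

Section NormalForms.
Variable E : choiceType.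
Implicit Types (d : E * bool) (k r : int).

(* [Tail k] stands for [a ^ k] and [Step r d x] for [a ^ r s_d x], where [s_d]
   is the stable letter of the edge [d] or its inverse, according to [d.2], and
   [s_d a ^ N (ebar d) = a ^ N d s_d].  The functions [addz k] and [cross d]
   below are left multiplication by [a ^ k] and by [s_d]. *)
Inductive nform : Type :=
| Tail of int
| Step of int & E * bool & nform.

Definition ebar d : E * bool := (d.1, ~~ d.2).

Lemma ebarK d : ebar (ebar d) = d.
Proof. by case: d => e b; rewrite /ebar /= negbK. Qed.

Lemma ebar_neq d : ebar d != d.
Proof. by case: d => e b; rewrite /ebar xpair_eqE /= andbC; case: b. Qed.

Implicit Types x y z : nform.

Fixpoint len x : nat := if x is Step _ _ x' then (len x').+1 else 0.

(** Tails are not compared: without its tail, a reduced form names a coset of [<a>], that is, a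
    vertex of the tree. *)
Fixpoint lcp x y : nat :=
  match x, y with
  | Step r d x', Step s f y' => if (r == s) && (d == f) then (lcp x' y').+1 else 0
  | _, _ => 0
  end.

Lemma lcp_ultra x y z : (minn (lcp x y) (lcp y z) <= lcp x z)%N.
Proof.
elim: x y z => [k|r d x IHx] [k'|s f y] [k''|t h z] //=; rewrite ?min0n ?minn0//.
case: ifP => [/andP[/eqP -> /eqP ->]|_]; last by rewrite min0n.
case: ifP => _; last by rewrite minn0.
by rewrite minnSS ltnS.
Qed.

Variable N : E * bool -> int.

Fixpoint addz k x : nform :=
  match x with
  | Tail j => Tail (k + j)
  | Step r d x' => Step ((k + r)%R %% N d)%Z d
                        (addz (((k + r)%R %/ N d)%Z * N (ebar d)) x')
  end.

Definition opens d x : bool :=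
  if x is Step r f _ then (r == 0) && (f == ebar d) else false.

Definition cross d x : nform :=
  match x with
  | Step r f x' => if (r == 0) && (f == ebar d) then x' else Step 0 d x
  | Tail _ => Step 0 d x
  end.

Fixpoint reduced x : bool :=
  if x is Step r d x' then
    [&& (r %% N d)%Z == r, ~~ opens d x' & reduced x'] else true.

Lemma len_addz k x : len (addz k x) = len x.
Proof. by elim: x k => //= r d x IHx k; rewrite IHx. Qed.

Hypothesis N0 : forall d, N d != 0.

Lemma addz0 x : reduced x -> addz 0 x = x.
Proof.
elim: x => [k|r d x IHx] /=; first by rewrite add0r.
case/and3P => /eqP rE _ redx; rewrite add0r rE.
suff -> : (r %/ N d)%Z = 0 by rewrite mul0r IHx.
apply: (mulIf (N0 d)); rewrite mul0r; have := divz_eq r (N d).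
by rewrite rE; lia.
Qed.

Lemma addzD j k x : addz j (addz k x) = addz (j + k) x.
Proof.
elim: x j k => [i|r d x IHx] j k /=; first by rewrite addrA.
have E1 : j + k + r =
    ((k + r)%R %/ N d)%Z * N d + (j + ((k + r)%R %% N d)%Z).
  by have := divz_eq (k + r) (N d); lia.
rewrite E1 modzMDl divzMDl// IHx; congr Step.
by rewrite mulrDl addrC.
Qed.

(** A carry across [d] is a multiple of [N (ebar d)], so it does not change the residue on which
    backtracking depends. *)
Lemma opens_addz d c x : reduced x ->
  opens d (addz (c * N (ebar d)) x) = opens d x.
Proof.
case: x => //= r f x /and3P[/eqP rE _ _].
case: (f =P ebar d) => [fE|_]; last by rewrite !andbF.
by rewrite !andbT -fE modzMDl rE.
Qed.

Lemma reduced_addz k x : reduced x -> reduced (addz k x).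
Proof.
elim: x k => //= r d x IHx k /and3P[rE nop redx].
rewrite modz_mod eqxx IHx// andbT /=.
by have := opens_addz d ((k + r)%R %/ N d)%Z redx => ->.
Qed.

Lemma reduced_cross d x : reduced x -> reduced (cross d x).
Proof.
case: x => [k|r f x]; first by rewrite /= mod0z eqxx.
move=> redx; rewrite /cross; case: ifP => [_|nop]; first by case/and3P: redx.
by rewrite -[reduced _]/[&& _ , ~~ ((r == 0) && (f == ebar d)) & reduced (Step r f x)]
  mod0z eqxx nop redx.
Qed.

Lemma crossE d x : ~~ opens d x -> cross d x = Step 0 d x.
Proof. by case: x => //= r f x /negbTE ->. Qed.

Lemma cross_ebar d x : cross d (Step 0 (ebar d) x) = x.
Proof. by rewrite /= !eqxx. Qed.

Lemma opensP d x : opens d x -> exists x', x = Step 0 (ebar d) x'.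
Proof. by case: x => //= r f x /andP[/eqP -> /eqP ->]; exists x. Qed.

Lemma crossK d x : reduced x -> cross d (cross (ebar d) x) = x.
Proof.
have [|nop] := boolP (opens (ebar d) x).
  move=> /opensP[x' ->]; rewrite cross_ebar ebarK => /and3P[_ nop _].
  exact: crossE.
by move=> _; rewrite (crossE nop) cross_ebar.
Qed.

Lemma cross_addz d x : reduced x ->
  cross d (addz (N (ebar d)) x) = addz (N d) (cross d x).
Proof.
move=> redx; have [op|nop] := boolP (opens d x).
  move: op => /opensP[x' xE]; rewrite xE cross_ebar /= addr0 modzz divzz N0 mul1r.
  by rewrite ebarK !eqxx.
rewrite (crossE nop) /= addr0 modzz divzz N0 mul1r crossE//.
by rewrite -[N _]mul1r opens_addz.
Qed.

End NormalForms.
Arguments Tail {E}.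

(** * Evaluation of normal forms along paths of a graph *)

Section Groupoid.
Variables (E : choiceType) (N : E * bool -> int).
Hypothesis N0 : forall d, N d != 0.
Variables (V : Type) (src tgt : E * bool -> V).
Hypothesis src_ebar : forall d, src (ebar d) = tgt d.
Variables (H : groupType) (al : V -> H) (tau : E * bool -> H).
Hypothesis tau_ebar : forall d, tau (ebar d) = (tau d)^-1%g.
Hypothesis tau_rel : forall d,
  (tau d * expgz (al (tgt d)) (N (ebar d)) =
   expgz (al (src d)) (N d) * tau d)%g.

Fixpoint valid (v w : V) (x : nform E) : Prop :=
  match x with
  | Tail _ => v = w
  | Step _ d x' => src d = v /\ valid (tgt d) w x'
  end.

(** The start vertex is an argument so that the same evaluation serves the rose, with one vertex,
    and the graph of groups, with values in its fundamental group. *)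
Fixpoint ev (v : V) (x : nform E) : H :=
  match x with
  | Tail k => expgz (al v) k
  | Step r d x' => (expgz (al v) r * (tau d * ev (tgt d) x'))%g
  end.

Lemma valid_addz k v w x : valid v w x -> valid v w (addz N k x).
Proof. by elim: x k v => //= r d x IHx k v [-> /IHx]. Qed.

Lemma ev_addz k v w x : valid v w x ->
  ev v (addz N k x) = (expgz (al v) k * ev v x)%g.
Proof.
elim: x k v => [j|r d x IHx] k v /=; first by rewrite expgzD.
move=> [<- valx]; rewrite IHx// mulrC expgzM (mulgA (tau d)).
have -> : (tau d * expgz (expgz (al (tgt d)) (N (ebar d))) ((k + r)%R %/ N d)%Z =
    expgz (expgz (al (src d)) (N d)) ((k + r)%R %/ N d)%Z * tau d)%g.
  set q := (_ %/ _)%Z; apply: (mulIg (tau d)^-1%g).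
  by rewrite -expgz_conj tau_rel mulgK mulgK.
rewrite -expgzM !mulgA -expgzD [N d * _]mulrC addrC -divz_eq expgzD.
by [].
Qed.

Lemma valid_cross d w x : valid (tgt d) w x -> valid (src d) w (cross d x).
Proof.
case: x => //= r f x; case: ifP => //= /andP[_ /eqP ->] [_].
by rewrite -src_ebar ebarK.
Qed.

Lemma ev_cross d w x : valid (tgt d) w x ->
  ev (src d) (cross d x) = (tau d * ev (tgt d) x)%g.
Proof.
case: x => [k|r f x]; first by rewrite /= expg0 mul1g.
rewrite /cross; case: ifP => [/andP[/eqP -> /eqP ->] _|_ _].
  by rewrite /= expg0 mul1g tau_ebar mulVKg -src_ebar ebarK.
by rewrite /= expg0 mul1g.
Qed.

End Groupoid.

(** * Multiple HNN extensions of the integers *)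

Inductive rose_rel (E : choiceType) (N : E * bool -> int) :
    word (option E) -> word (option E) -> Prop :=
| rose_rel_edge e : rose_rel N
    (gen (Some e) ++ genexp None (N (e, true)) ++ geninv (Some e))
    (genexp None (N (e, false))).

Section Rose.
Variables (E : choiceType) (N : E * bool -> int).
Hypothesis N0 : forall d, N d != 0.
Implicit Types (d : E * bool) (x y z : nform E).

Definition rose : groupType := presented (rose_rel N).
Implicit Types g h : rose.

Definition ra : rose := pgen (rose_rel N) None.
Definition rs d : rose :=
  if d.2 then (pgen (rose_rel N) (Some d.1))^-1%g
  else pgen (rose_rel N) (Some d.1).

Lemma rs_ebar d : rs (ebar d) = (rs d)^-1%g.
Proof. by case: d => e [] //; rewrite /rs /= invgK. Qed.

Lemma rs_rel d :
  (rs d * expgz ra (N (ebar d)) = expgz ra (N d) * rs d)%g.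
Proof.
have H e : (rs (e, false) * expgz ra (N (e, true)) =
            expgz ra (N (e, false)) * rs (e, false))%g.
  have /(pclassP (rose_rel N)) := word_eq_rel (rose_rel_edge N e).
  rewrite !pclass_cat pclass_geninv !pclass_genexp => H.
  by rewrite -[expgz ra (N (e, false))]H !mulgA mulgVK.
case: d => e []; last exact: H.
rewrite /ebar /= -[rs (e, true)]/(rs (e, false))^-1%g.
by apply: (mulgI (rs (e, false))); rewrite mulVKg mulgA H mulgK.
Qed.

Lemma rose_ind (P : rose -> Prop) : P 1%g ->
  (forall k g, P g -> P (expgz ra k * g)%g) ->
  (forall d g, P g -> P (rs d * g)%g) -> forall g, P g.
Proof.
move=> P1 Pa Ps; apply: presented_ind => // [[e|]|[e|]] g Pg.
- exact: (Ps (e, false)).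
- by rewrite -[pgen _ _]expgz1; exact: Pa.
- exact: (Ps (e, true)).
- by rewrite -[(pgen _ _)^-1%g]expgz1 -(expgzN _ 1) expgz1 -/ra; exact: Pa.
Qed.

Definition nact (l : option E * bool) x : nform E :=
  if l.1 is Some e then cross (e, l.2) x
  else addz N (if l.2 then -1 else 1) x.

Lemma nact_reduced l x : reduced N x -> reduced N (nact l x).
Proof.
by case: l => [[e|] b]; [exact: reduced_cross|exact: reduced_addz].
Qed.

Lemma nactK l b x : reduced N x -> nact (l, b) (nact (l, ~~ b) x) = x.
Proof.
case: l => [e|] redx; first exact: (@crossK _ N (e, b) x redx).
rewrite /nact /= (addzD N0); case: b; rewrite /= ?addNr ?subrr; exact: addz0.
Qed.

Lemma wact_genexp k x : reduced N x ->
  wact nact (genexp None k) x = addz N k x.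
Proof.
move=> redx; case: k => n /=.
  elim: n => [|n IHn]; first by rewrite addz0.
  by rewrite /= IHn /nact /= (addzD N0).
rewrite NegzE; elim: n => [|n IHn] //=.
rewrite /= in IHn; rewrite IHn /nact /= (addzD N0); congr addz; lia.
Qed.

Lemma nact_rel u v x : rose_rel N u v -> reduced N x ->
  wact nact u x = wact nact v x.
Proof.
case=> e redx; rewrite !wact_cat (wact_genexp _ redx).
have redc : reduced N (cross (e, true) x) by exact: reduced_cross.
rewrite -[wact nact (geninv _) x]/(cross (e, true) x) wact_genexp//.
rewrite -[wact nact (gen _) _]/(cross (e, false) _).
rewrite -[(e, true)]/(ebar (e, false)) cross_addz//.
by rewrite (@crossK _ N (e, false)).
Qed.

Definition act (g : rose) x : nform E := pact nact g x.

Lemma act_reduced g x : reduced N x -> reduced N (act g x).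
Proof. exact: pact_inv nact_reduced _ _. Qed.

Lemma act1 x : reduced N x -> act 1%g x = x.
Proof. exact: (pact1 nact_reduced nactK nact_rel). Qed.

Lemma actM g h x : reduced N x -> act (g * h)%g x = act g (act h x).
Proof. exact: (pactM nact_reduced nactK nact_rel). Qed.

Lemma act_ra k x : reduced N x -> act (expgz ra k) x = addz N k x.
Proof.
move=> redx; rewrite -pclass_genexp.
by rewrite [LHS](pact_pclass nact_reduced nactK nact_rel)// wact_genexp.
Qed.

Lemma act_rs d x : reduced N x -> act (rs d) x = cross d x.
Proof.
move=> redx; case: d => e []; rewrite /rs /= -?pclass_geninv;
  by rewrite [LHS](pact_pclass nact_reduced nactK nact_rel).
Qed.

Definition nf g : nform E := act g (Tail 0).

Lemma nf_reduced g : reduced N (nf g).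
Proof. exact: act_reduced. Qed.

Lemma nfM g h : nf (g * h)%g = act g (nf h).
Proof. exact: actM. Qed.

Lemma nf1 : nf 1%g = Tail 0.
Proof. exact: act1. Qed.

Definition evr : nform E -> rose :=
  ev (fun=> tt) (fun=> ra) rs tt.

Lemma valid_unit (v w : unit) x : valid (fun=> tt) (fun=> tt) v w x.
Proof. by elim: x v => [k|r d x IHx] [] /=; [case: w|split]. Qed.

Lemma evr_nf g : evr (nf g) = g.
Proof.
elim/rose_ind: g => [|k g IHg|d g IHg]; first by rewrite nf1.
  rewrite nfM act_ra ?nf_reduced//.
  rewrite /evr (@ev_addz E N unit (fun=> tt) (fun=> tt) _ (fun=> ra) rs rs_rel k
    tt tt)//; last exact: valid_unit.
  by rewrite -/(evr _) IHg.
rewrite nfM act_rs ?nf_reduced//.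
rewrite /evr (@ev_cross E unit (fun=> tt) (fun=> tt) _ _ (fun=> ra) rs rs_ebar
    d tt)//; last exact: valid_unit.
by rewrite -/(evr _) IHg.
Qed.

Lemma nf_Tail g k : nf g = Tail k -> g = expgz ra k.
Proof. by move=> gk; rewrite -[g]evr_nf gk. Qed.

Definition rlen g : nat := len (nf g).
Definition rgp g h : nat := lcp (nf g) (nf h).

Lemma rlen_ra k : rlen (expgz ra k) = 0.
Proof. by rewrite /rlen /nf act_ra. Qed.

Lemma rlen_eq0 g : rlen g = 0 -> exists k, g = expgz ra k.
Proof.
by rewrite /rlen; case gE: (nf g) => [k|//] _; exists k; exact: nf_Tail.
Qed.

Lemma rgp_ultra g h k : (minn (rgp g h) (rgp h k) <= rgp g k)%N.
Proof. exact: lcp_ultra. Qed.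

(** The tree distance formula: common first steps cancel one by one, and after the first
    disagreement the reversed rest of [x] followed by that of [y] is reduced. *)
Lemma len_act_inv x y : reduced N x -> reduced N y ->
  (len (act (evr x)^-1%g y) + (lcp x y).*2 = len x + len y)%N.
Proof.
elim: x y => [k|r d x IHx] y.
  by move=> _ redy; rewrite /evr /= -expgzN act_ra// len_addz addn0.
move=> /and3P[/eqP rE nop redx] redy.
have -> : evr (Step r d x) = (expgz ra r * (rs d * evr x))%g by [].
rewrite !invgM actM// actM; last exact: act_reduced.
rewrite -expgzN act_ra// -rs_ebar act_rs; last exact: reduced_addz.
have redy1 := reduced_addz (- r) redy.
have [[y' yE]|ndy] := pselect (exists y', y = Step r d y').
  rewrite yE /= addNr mod0z div0z mul0r in redy redy1 *.
  rewrite ebarK !eqxx /= (addz0 N0); last by case/and3P: redy.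
  have {redy} redy' : reduced N y' by case/and3P: redy.
  by move: (IHx y' redx redy'); rewrite addSn addnS doubleS !addnS => ->.
have nopen : ~~ opens (ebar d) (addz N (- r) y).
  case: y redy ndy {redy1} => //= s f y /and3P[/eqP sE _ _] ndy.
  rewrite ebarK; apply/negP => /andP[/eqP rs0 /eqP fd]; apply: ndy; exists y.
  rewrite fd in sE rs0 *; congr Step.
  have -> : s = ((r + (- r + s)) %% N d)%Z by rewrite addrA subrr add0r sE.
  by rewrite -modzDmr rs0 addr0 rE.
rewrite (crossE nopen).
have -> : lcp (Step r d x) y = 0.
  case: y ndy {redy redy1 nopen} => //= s f y ndy.
  case: ifP => // /andP[/eqP rs0 /eqP df]; case: ndy; exists y.
  by rewrite rs0 df.
have redc : reduced N (Step 0 (ebar d) (addz N (- r) y)).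
  by rewrite -(crossE nopen); exact: reduced_cross.
have := IHx _ redx redc; rewrite /= len_addz.
have -> : lcp x (Step 0 (ebar d) (addz N (- r) y)) = 0.
  case: x nop {IHx redx} => //= s f x nop.
  by rewrite (negbTE nop).
by rewrite !addn0 => ->; rewrite addnS addSn.
Qed.

Lemma rgp_rlen g h : (rlen (g^-1 * h)%g + (rgp g h).*2 = rlen g + rlen h)%N.
Proof.
have := len_act_inv (nf_reduced g) (nf_reduced h).
by rewrite evr_nf -nfM.
Qed.

(** The inverse of such an element starts along the reversed edge. This is the case of an edge
    inversion, excluded in the cyclic reduction. *)
Lemma rgp_inv_edge g : rlen g = 1 -> rgp g g^-1%g = 0.
Proof.
rewrite /rlen /rgp; case gE: (nf g) => [//|r d [k|//]] _.
have := nf_reduced g; rewrite gE => /and3P[_ _ _].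
have -> : g^-1%g = ((expgz ra k)^-1 * ((rs d)^-1 * (expgz ra r)^-1))%g.
  by rewrite -[g]evr_nf gE /evr /= !invgM mulgA.
rewrite -!expgzN -rs_ebar !nfM /nf act_ra// act_rs//= act_ra//=; last first.
  by rewrite mod0z eqxx.
by rewrite (eq_sym d) (negbTE (ebar_neq d)) andbF.
Qed.

End Rose.

(** * The modulus and cyclic reduction *)

Section RoseModulus.
Variables (E : choiceType) (N : E * bool -> int).
Hypothesis N0 : forall d, N d != 0.
Implicit Types (d : E * bool) (g h p u : rose N).

Definition edge_ratio d : rat := (N d)%:~R / (N (ebar d))%:~R.

Lemma edge_ratioK d : edge_ratio d * edge_ratio (ebar d) = 1.
Proof.
by rewrite /edge_ratio ebarK mulrA divfK ?divff// intr_eq0.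
Qed.

(** The affine action: [a] is translation by 1 and the stable letter of [d] is scaling by
    [edge_ratio d]. *)
Definition affl (l : option E * bool) (q : rat) : rat :=
  if l.1 is Some e then edge_ratio (e, l.2) * q
  else (if l.2 then -1 else 1) + q.

Lemma afflK x b q : True -> affl (x, b) (affl (x, ~~ b) q) = q.
Proof.
move=> _; case: x => [e|]; rewrite /affl /=.
  by rewrite mulrA (edge_ratioK (e, b)) mul1r.
by case: b; rewrite addrA ?addNr ?subrr add0r.
Qed.

Lemma wact_affl_genexp k q : wact affl (genexp None k) q = k%:~R + q.
Proof.
case: k => n /=.
  elim: n => [|n IHn]; first by rewrite add0r.
  by rewrite /= IHn /affl /= addrA -(add1n n) PoszD rmorphD.
rewrite NegzE; elim: n => [|n IHn] //=.
by rewrite /= in IHn; rewrite IHn /affl /= addrA -(add1n n.+1) PoszD opprD rmorphD.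
Qed.

Lemma affl_rel (v w : word (option E)) q :
  rose_rel N v w -> True -> wact affl v q = wact affl w q.
Proof.
case=> e _; rewrite !wact_cat wact_affl_genexp wact_affl_genexp.
rewrite -[wact affl (gen _) _]/(edge_ratio (e, false) * _).
rewrite -[wact affl (geninv _) q]/(edge_ratio (e, true) * q).
rewrite mulrDr mulrA (edge_ratioK (e, false)) mul1r; congr (_ + _).
by rewrite divfK// intr_eq0.
Qed.

Definition aff g (q : rat) : rat := pact affl g q.

Let affT (l : option E * bool) (q : rat) : True -> True := id.

Lemma affM g h q : aff (g * h)%g q = aff g (aff h q).
Proof. exact: (pactM affT afflK affl_rel). Qed.

Lemma aff1 q : aff 1%g q = q.
Proof. exact: (pact1 affT afflK affl_rel). Qed.

Lemma aff_ra k q : aff (expgz (ra N) k) q = k%:~R + q.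
Proof.
rewrite -pclass_genexp [LHS](pact_pclass affT afflK affl_rel)//.
exact: wact_affl_genexp.
Qed.

Lemma aff_rs d q : aff (rs N d) q = edge_ratio d * q.
Proof.
case: d => e []; rewrite /rs /= -?pclass_geninv;
  by rewrite [LHS](pact_pclass affT afflK affl_rel).
Qed.

Definition modulus g : rat := aff g 1 - aff g 0.

Lemma affE g q : aff g q = modulus g * q + aff g 0.
Proof.
rewrite /modulus; elim/rose_ind: g q => [|k g IHg|d g IHg] q.
- by rewrite !aff1; ring.
- by rewrite !affM !aff_ra IHg; ring.
- by rewrite !affM !aff_rs IHg; ring.
Qed.

Lemma modulusM : {morph modulus : g h / (g * h)%g >-> g * h}.
Proof.
move=> g h; rewrite {1}/modulus !affM (affE g (aff h 1)) (affE g (aff h 0)).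
by rewrite /modulus; ring.
Qed.

Lemma modulus_ra k : modulus (expgz (ra N) k) = 1.
Proof. by rewrite /modulus !aff_ra; ring. Qed.

Lemma modulus1 : modulus 1%g = 1. Proof. exact: (modulus_ra 0). Qed.

Lemma modulusV g : modulus g * modulus g^-1%g = 1.
Proof. by rewrite -modulusM mulgV modulus1. Qed.

Lemma modulus_neq0 g : modulus g != 0.
Proof.
apply/eqP => g0; have := modulusV g; rewrite g0 mul0r.
by move/eqP; rewrite eq_sym oner_eq0.
Qed.

Lemma modulusVE g : modulus g^-1%g = (modulus g)^-1.
Proof. by apply: (mulfI (modulus_neq0 g)); rewrite modulusV divff// modulus_neq0. Qed.

Lemma modulusJ p g : modulus (p * g * p^-1)%g = modulus g.
Proof. by rewrite !modulusM modulusVE mulrAC divff ?mul1r// modulus_neq0. Qed.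

Lemma ra_inj : injective (expgz (ra N)).
Proof.
move=> i j ij; apply: (@intr_inj rat).
by have := congr1 (fun g => aff g 0) ij; rewrite !aff_ra !addr0.
Qed.

Lemma modulus_conj g i j :
  (g * expgz (ra N) i * g^-1)%g = expgz (ra N) j -> modulus g * i%:~R = j%:~R.
Proof.
move=> /(canRL (mulgK _)); rewrite invgK => /(congr1 (fun g => aff g 0)).
by rewrite !affM !aff_ra affE !addr0; apply: addIr.
Qed.

(** Vertex stabilisers are commensurable: the edge relation can be applied once the exponents are
    multiplied by the indices of the edge. *)
Lemma commensurable g : exists i j : int, [/\ i != 0, j != 0 &
  (g * expgz (ra N) i = expgz (ra N) j * g)%g].
Proof.
elim/rose_ind: g => [|k g [i [j [i0 j0 gE]]]|d g [i [j [i0 j0 gE]]]].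
- by exists 1, 1; rewrite mul1g mulg1.
- exists i, j; split=> //.
  by rewrite -mulgA gE !mulgA expgz_commute.
- exists (i * N (ebar d)), (j * N d); rewrite !mulf_neq0//; split=> //.
  rewrite -mulgA expgzM.
  have -> : (g * expgz (expgz (ra N) i) (N (ebar d)) =
      expgz (expgz (ra N) j) (N (ebar d)) * g)%g.
    apply: (mulIg g^-1%g); rewrite -expgz_conj gE mulgK.
    by rewrite mulgK.
  have -> : expgz (expgz (ra N) j) (N (ebar d)) =
      expgz (expgz (ra N) (N (ebar d))) j by rewrite -!expgzM mulrC.
  rewrite (mulgA (rs N d)).
  have -> : (rs N d * expgz (expgz (ra N) (N (ebar d))) j =
      expgz (expgz (ra N) (N d)) j * rs N d)%g.
    apply: (mulIg (rs N d)^-1%g); rewrite -expgz_conj rs_rel mulgK.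
    by rewrite mulgK.
  by rewrite -expgzM (mulrC j) mulgA.
Qed.

Lemma rlen1 : rlen (1%g : rose N) = 0%N.
Proof. exact: (rlen_ra N0 0). Qed.

Lemma rlen_rgp g h : (rlen (g^-1 * h)%g + 2 * rgp g h = rlen g + rlen h)%N.
Proof. by rewrite mul2n; exact: rgp_rlen. Qed.

(** If g and g^-1 start with the same step, conjugating by that step shortens g by two; otherwise
    [len_expg] applies. *)
Lemma cyclic_reduction g : exists p,
  (exists k, (p * g * p^-1)%g = expgz (ra N) k) \/
  (0 < rlen (p * g * p^-1)%g)%N /\
  (forall n : nat, rlen ((p * g * p^-1) ^+ n)%g = n * rlen (p * g * p^-1)%g)%N.
Proof.
have [m] := ubnP (rlen g); elim: m g => [//|m IHm] g; rewrite ltnS => gm.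
have [l0|l0] := posnP (rlen g).
  by exists 1%g; left; rewrite invg1 mul1g mulg1; exact: rlen_eq0.
have [c0|c0] := posnP (rgp g^-1%g g).
  exists 1%g; right; rewrite invg1 mul1g mulg1; split=> // n.
  exact: (len_expg rlen1 rlen_rgp (@rgp_ultra _ _)).
have gC := gromovC rlen1 rlen_rgp (@rgp_ultra _ N).
have gV := lenV rlen1 rlen_rgp (@rgp_ultra _ N).
have l2 : (1 < rlen g)%N.
  rewrite ltn_neqAle eq_sym l0 andbT; apply/eqP => /(rgp_inv_edge N0).
  by rewrite gC; lia.
case gE : (nf g) => [k|r d x]; first by rewrite /rlen gE in l0.
have := nf_reduced g; rewrite gE => /and3P[/eqP rE _ _].
pose u : rose N := (expgz (ra N) r * rs N d)%g.
have [k uE] : exists k, nf u = Step r d (Tail k).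
  have nrs : nf (rs N d) = Step 0 d (Tail 0) by rewrite /nf act_rs.
  rewrite /u nfM// nrs act_ra//=; last by rewrite mod0z eqxx.
  by rewrite addr0 rE; eexists.
have ug : rgp u g = 1%N by rewrite /rgp uE gE /= !eqxx.
have ugV : rgp u g^-1%g = 1%N.
  move: c0; rewrite /rgp uE gE; case: (nf g^-1%g) => //= s f y.
  by rewrite (eq_sym r) (eq_sym d); case: ifP.
have lu : rlen u = 1%N by rewrite /rlen uE.
have a1 := rlen_rgp u g; have a2 := rlen_rgp u g^-1%g.
have a3 : rlen (u^-1 * g^-1)%g = rlen (g * u)%g by rewrite -[LHS]gV invgM !invgK.
have a4 := rlen_rgp g (g * u)%g; rewrite mulKg in a4.
have a5 := rlen_rgp u (g * u)%g.
have a6 := rgp_ultra u g (g * u)%g.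
have [|p pP] := IHm (u^-1 * g * u)%g.
  rewrite -mulgA; rewrite ug lu in a1; rewrite ugV lu a3 gV in a2.
  rewrite lu in a4 a5; rewrite ug in a6.
  move: a1 a2 a4 a5 a6 gm l2; clear; lia_upto (@rlen _ N) (@rgp _ N).
exists (p * u^-1)%g.
have <- // : (p * (u^-1 * g * u) * p^-1 = p * u^-1 * g * (p * u^-1)^-1)%g.
by rewrite (invgM p) invgK !mulgA.
Qed.

End RoseModulus.

(** * Subgroups of roses *)

Section RoseSubgroup.
Variables (E : choiceType) (N : E * bool -> int).
Hypothesis N0 : forall d, N d != 0.
Variables (G : groupType) (phi : {multiplicative G -> rose N}).
Hypothesis phi_inj : injective phi.
Local Notation a := (ra N).
Local Notation mod := (modulus (N := N)).

(** Conjugation by [z] changes lengths by at most 2 [rlen z], whereas passing to j-th powers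
    multiplies the gap between the lengths by j. *)
Lemma cyclic_length_le (y : rose N) (m n : int) (z : rose N) (k : nat) :
  (0 < k)%N -> (forall j : nat, rlen (y ^+ j)%g = j * k)%N ->
  (z * expgz y m * z^-1)%g = expgz y n -> (`|n| <= `|m|)%N.
Proof.
move=> k0 Ly E0; rewrite leqNgt; apply/negP => mn.
have gV := lenV (rlen1 N0) (rlen_rgp N0) (@rgp_ultra _ N).
have gM := lenM (rlen1 N0) (rlen_rgp N0) (@rgp_ultra _ N).
have LyZ (i : int) : rlen (expgz y i) = (`|i| * k)%N.
  by case: i => i /=; rewrite ?gV Ly.
pose j := (2 * rlen z).+1.
have := LyZ (n * j%:Z); rewrite expgzM -E0 expgz_conj -expgzM => E1.
have := gM (z * expgz y (m * j%:Z))%g z^-1%g; rewrite E1 gV.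
have := gM z (expgz y (m * j%:Z)); rewrite LyZ !abszM absz_nat => h1 h2.
have h3 : (`|n| * j * k <= `|m| * j * k + 2 * rlen z)%N by lia.
have : (j * k <= 2 * rlen z)%N.
  have : ((`|m| + 1) * j * k <= `|n| * j * k)%N.
    by rewrite !leq_mul2r addn1 mn !orbT.
  by rewrite addn1 mulSn mulnDl; lia.
apply/negP; rewrite -ltnNge; apply: (@leq_trans j) => //.
exact: leq_pmulr.
Qed.

(** If [y] is elliptic, the modulus compares [m] and [n]; if it is hyperbolic, translation lengths
    do, the inequality being used in both directions. *)
Lemma unimodular_modulus : (forall x, `|mod (phi x)| = 1) -> unimodular G.
Proof.
move=> mod1 x y _ y1 m n xy.
have [p [[k yk]|[l0 Ly]]] := cyclic_reduction N0 (phi y).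
  have k0 : k != 0.
    apply: contraNneq y1 => k0; move: yk; rewrite k0 expgz0.
    move=> /(canRL (mulgK _)); rewrite mul1g invgK => /(canRL (mulKg _)).
    by rewrite mulVg -(gmulf1g phi) => /phi_inj ->.
  have /modulus_conj : ((p * phi x * p^-1) * expgz a (k * m) *
      (p * phi x * p^-1)^-1 = expgz a (k * n))%g.
    rewrite !expgzM -!yk !expgz_conj -!gmulf_expgz -xy !gmulfM gmulfVg.
    by rewrite !invgM invgK !mulgA !mulgVK.
  move=> /(_ N0); rewrite modulusJ// => /(congr1 Num.norm); rewrite normrM mod1 mul1r.
  rewrite !rmorphM !normrM => /(mulfI _) H.
  apply: (@intr_inj rat); rewrite !intr_norm; apply: H.
  by rewrite normr_eq0 intr_eq0.
have xy' : ((p * phi x * p^-1) * expgz (p * phi y * p^-1) m *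
    (p * phi x * p^-1)^-1 = expgz (p * phi y * p^-1) n)%g.
  rewrite !expgz_conj -!gmulf_expgz -xy !gmulfM gmulfVg.
  by rewrite !invgM invgK !mulgA !mulgVK.
have yx' : ((p * phi x * p^-1)^-1 * expgz (p * phi y * p^-1) n *
    (p * phi x * p^-1)^-1^-1 = expgz (p * phi y * p^-1) m)%g.
  move: xy'; set z := (p * phi x * p^-1)%g => <-.
  by rewrite -(mulgA z) mulKg mulgK.
have h1 := cyclic_length_le l0 Ly xy'; have h2 := cyclic_length_le l0 Ly yx'.
lia.
Qed.

Lemma bernoulli_unbounded (x : rat) (y : rat) : 1 < x -> exists n : nat, y < x ^+ n.
Proof.
move=> x1; pose e := x - 1; have e0 : 0 < e by rewrite subr_gt0.
have B (n : nat) : 1 + n%:R * e <= x ^+ n.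
  elim: n => [|n IHn]; first by rewrite mul0r addr0.
  have xE : x = 1 + e by rewrite /e addrC subrK.
  rewrite exprS; apply: (@le_trans _ _ (x * (1 + n%:R * e))).
    rewrite {1}xE -natr1 -subr_ge0.
    have -> : (1 + e) * (1 + n%:R * e) - (1 + (n%:R + 1) * e) = n%:R * (e * e).
      by ring.
    by rewrite mulr_ge0// mulr_ge0// ltW.
  by rewrite ler_wpM2l// (le_trans ler01)// ltW.
exists (Num.trunc (`|y| / e)).+1; apply: lt_le_trans (B _).
have : `|y| / e < (Num.trunc (`|y| / e)).+1%:R.
  have /andP[] // : ((Num.trunc (`|y| / e))%:R <= `|y| / e <
    (Num.trunc (`|y| / e)).+1%:R).
  by rewrite trunc_itv// divr_ge0// ltW.
rewrite ltr_pdivrMr// => h; apply: le_lt_trans (ler_norm y) _.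
by apply: lt_trans h _; rewrite ltrDr.
Qed.

Lemma rose_subgroup (R : realType) (b0 : G) (k0 : int) (p0 : rose N) :
  k0 != 0 -> phi b0 = (p0 * expgz a k0 * p0^-1)%g -> ~ Cstar_simple R G ->
  (exists n : int, n != 0 /\ isomorphic G (BS1 n)) \/ unimodular G.
Proof.
move=> k00 b0E nsimp.
have [uni|nuni] := pselect (forall x, `|mod (phi x)| = 1).
  by right; exact: unimodular_modulus.
left.
have [t t1] : exists t, 1 < `|mod (phi t)|.
  have [x x1] : exists x, `|mod (phi x)| != 1.
    apply: contrapT => H; apply: nuni => x; apply/eqP/negPn/negP => x1.
    by apply: H; exists x.
  have [lt|gt|eq1] := ltgtP `|mod (phi x)| 1; last by rewrite eq1 eqxx in x1.
    exists x^-1%g; rewrite gmulfVg modulusVE// normfV invf_gt1//.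
    by rewrite normr_gt0 modulus_neq0.
  by exists x.
(* An elliptic element has modulus 1, so [t] is hyperbolic; conjugation by [p] puts the base vertex
   on its axis. *)
have [p [[k tk]|[l0 Lt]]] := cyclic_reduction N0 (phi t).
  by have := modulusJ N0 p (phi t); rewrite tk modulus_ra// => m1; rewrite -m1 normr1 ltxx in t1.
pose psi g := (p * phi g * p^-1)%g.
have psiM : {morph psi : g h / (g * h)%g}.
  by move=> g h; rewrite /psi gmulfM !mulgA mulgVK.
have psi_inj : injective psi by move=> g h /mulIg/mulgI/phi_inj.
have psiV g : psi g^-1%g = (psi g)^-1%g.
  by rewrite /psi gmulfVg !invgM invgK !mulgA.
have psi1 : psi 1%g = 1%g by rewrite /psi gmulf1g mulg1 mulgV.
have psiX g (n : nat) : psi (g ^+ n)%g = (psi g ^+ n)%g.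
  by elim: n => [|n IHn]; rewrite ?expg0 ?psi1// !expgS psiM IHn.
have psiZ g (n : int) : psi (expgz g n) = expgz (psi g) n.
  by case: n => n /=; rewrite ?psiV psiX.
pose L g := rlen (psi g); pose c g h := rgp (psi g) (psi h).
have L1 : L 1%g = 0%N by rewrite /L psi1 rlen1.
have Lc (g h : G) : (L (g^-1 * h)%g + 2 * c g h = L g + L h)%N.
  by rewrite /L psiM psiV; exact: rlen_rgp.
have cu g h k : (minn (c g h) (c h k) <= c g k)%N by exact: rgp_ultra.
have LtX (n : nat) : L (t ^+ n)%g = (n * L t)%N by rewrite /L psiX; exact: Lt.
have modpsi g : mod (psi g) = mod (phi g) by rewrite /psi modulusJ.
have L0 g : L g = 0%N -> exists k, psi g = expgz a k by exact: rlen_eq0.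
(* A generator of the stabiliser of the base vertex. *)
have [b [k [kpos bk kmin]]] : exists b (k : nat), [/\ (0 < k)%N,
    psi b = expgz a k & forall g i, psi g = expgz a i -> (k %| i)%Z].
  pose P k := `[< exists g, psi g = expgz a k.+1 >].
  have exP : exists k, P k.
    (* By commensurability a power of the elliptic element [b0] fixes the base vertex. *)
    have [i [j [i0 j0 E0]]] := commensurable N0 (p * p0)%g.
    have E1 : psi (expgz b0 i) = expgz a (k0 * j).
      rewrite psiZ /psi b0E.
      have -> : (p * (p0 * expgz a k0 * p0^-1) * p^-1 =
          (p * p0) * expgz a k0 * (p * p0)^-1)%g by rewrite (invgM p) !mulgA.
      have ki : expgz (expgz a k0) i = expgz (expgz a i) k0.
        by rewrite -!expgzM mulrC.
      by rewrite expgz_conj ki -expgz_conj E0 mulgK -expgzM mulrC.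
    have kj0 : k0 * j != 0 by rewrite mulf_neq0.
    case E2 : (k0 * j) kj0 E1 => [[|n]|n] // _ E1.
      by exists n; apply/asboolP; exists (expgz b0 i).
    exists n; apply/asboolP; exists (expgz b0 i)^-1%g.
    by rewrite psiV E1 NegzE expgzN invgK.
  have [k /asboolP[b bk] min] := ex_minnP exP; exists b, k.+1; split=> // g i gi.
  apply/dvdz_mod0P; set r := (_ %% _)%Z.
  have gr : psi (g * expgz b (- (i %/ k.+1)%Z))%g = expgz a r.
    rewrite psiM psiZ gi bk -expgzM -expgzD; congr expgz.
    by rewrite {1}(divz_eq i k.+1) -/r mulrN [k.+1%:Z * _]mulrC addrAC subrr add0r.
  have r0 : 0 <= r by rewrite modz_ge0.
  have rk : r < k.+1 by rewrite ltz_pmod.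
  case rE : r r0 => [[|q]|q] // _.
  have /min : P q by apply/asboolP;
    exists (g * expgz b (- (i %/ k.+1)%Z))%g; rewrite gr rE.
  by move: rk; rewrite rE; lia.
have psib (i : int) : psi (expgz b i) = expgz a (k%:Z * i) by rewrite psiZ bk expgzM.
have Lb (i : int) : L (expgz b i) = 0%N by rewrite /L psib rlen_ra.
have b_inj : injective (expgz b).
  move=> i j ij; have := congr1 psi ij; rewrite !psib => /(ra_inj N0).
  by apply: mulfI; move: kpos; case: (k).
have [[s ns]|fixed] := pselect (exists s,
    ~ conv c (fun n => s * t^-1 ^+ n)%g (fun n => t^-1 ^+ n)%g).
  case: nsimp; apply: powers_Cstar_simple.
  apply: (lyndon_powers L1 Lc cu l0 LtX _ _ _ ns (b := b)).
  (* If [f] fixes the half-axis then i = (modulus of t)^n j for every n; an n with |i| below the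
     n-th power of |modulus| gives j = 0 and hence i = 0. *)
  - move=> f Lf.
    have kf n : exists k, psi (t ^- n * (f * t ^+ n))%g = expgz a k.
      by apply: L0; exact: Lf.
    have [i fi] := kf 0%N; rewrite expg0 invg1 mul1g mulg1 in fi.
    have [i0|i0] := eqVneq i 0.
      by apply: psi_inj; rewrite fi i0 expgz0 psi1.
    have [n in_] := bernoulli_unbounded `|i%:~R| t1.
    have [j fj] := kf n.
    have := @modulus_conj _ _ N0 (psi (t ^- n)%g) i j.
    rewrite -fi -fj -psiV -!psiM invgK mulgA => /(_ erefl).
    rewrite psiV psiX modulusVE// => E0.
    have modX g (q : nat) : mod (g ^+ q)%g = mod g ^+ q.
      elim: q => [|q IHq]; first by rewrite expg0 modulus1.
      by rewrite expgS exprS modulusM// IHq.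
    have j0 : j != 0.
      apply: contraNneq i0 => j0; move/eqP: E0; rewrite j0 mulf_eq0 invr_eq0.
      by rewrite (negbTE (modulus_neq0 N0 _)) intr_eq0.
    have E1 : i%:~R = mod (phi t) ^+ n * j%:~R.
      by rewrite -E0 mulrA modX modpsi divff ?mul1r// expf_neq0// modulus_neq0.
    move: in_; rewrite E1 normrM normrX ltNge ler_peMr ?exprn_ge0//.
    rewrite -intr_norm -[1]/(1%:~R) ler_int; lia.
  - move=> i i0 bi; have : expgz b i = expgz b 0 by exact: bi.
    by move/b_inj; lia.
  - by move=> i; exact: (Lb i).
(* The end fixed by the group is the repelling end of [t], that is, the attracting end of its
   inverse. *)
apply: (@fixed_end_BS1 G L c L1 Lc cu t^-1%g b (L t) (fun g => mod (psi g))) => //.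
- by move=> n; rewrite expVgn (lenV L1 Lc cu) LtX.
- move=> g /L0[i gi]; have /dvdzP[q iq] := kmin _ _ gi; exists q.
  by apply: psi_inj; rewrite gi psib iq mulrC.
- by move=> g h; rewrite psiM modulusM.
- by move=> g; exact: modulus_neq0.
- move=> g i j E0; have := congr1 psi E0; rewrite !psiM psiV !psib => /modulus_conj.
  move=> /(_ N0); rewrite !rmorphM /= mulrCA => /mulfI; apply.
  by rewrite pnatr_eq0 -lt0n.
- by move=> s; apply: contrapT => ns; apply: fixed; exists s.
Qed.

End RoseSubgroup.

(** * Potentials on spanning trees *)

Section Holonomy.
Variables (Y : graph_of_groups) (T : {set edge Y}).
Implicit Types (d : oedge Y) (s : seq (oedge Y)) (v : vert Y).

Fixpoint walk v s : bool :=
  if s is d :: s' then [&& osrc d == v, d.1 \in T & walk (otgt d) s'] else true.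

Definition wend v s : vert Y := last v [seq otgt d | d <- s].

Lemma walk_cat v s1 s2 : walk v (s1 ++ s2) = walk v s1 && walk (wend v s1) s2.
Proof. by elim: s1 v => //= d s1 IH v; rewrite IH !andbA. Qed.

Lemma wend_cat v s1 s2 : wend v (s1 ++ s2) = wend (wend v s1) s2.
Proof. by rewrite /wend map_cat last_cat. Qed.

Lemma osrc_obar d : osrc (obar d) = otgt d.
Proof. by case: d => e []. Qed.

Lemma otgt_obar d : otgt (obar d) = osrc d.
Proof. by case: d => e []. Qed.

Lemma obarK d : obar (obar d) = d.
Proof. by case: d => e b; rewrite /obar /= negbK. Qed.

Lemma obar_neq d : d != obar d.
Proof. by case: d => e []; rewrite /obar xpair_eqE /= andbF. Qed.

Lemma walk_rev v s : walk v s ->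
  walk (wend v s) (rev [seq obar d | d <- s]) /\
  wend (wend v s) (rev [seq obar d | d <- s]) = v.
Proof.
elim: s v => //= d s IH v /and3P[/eqP dv dT /IH[ws we]].
rewrite rev_cons -cats1 walk_cat wend_cat ws we /= osrc_obar eqxx dT.
by rewrite /wend /= otgt_obar.
Qed.

Definition no_backtrack : rel (oedge Y) := fun d d' => d' != obar d.

Lemma backtrackP s : ~~ sorted no_backtrack s ->
  exists s1 d s2, s = s1 ++ [:: d, obar d & s2].
Proof.
elim: s => //= d [|d' s] IH //=; rewrite negb_and => /orP[|/IH[s1 [f [s2 sE]]]].
  by rewrite /no_backtrack negbK => /eqP ->; exists [::], d, s.
by exists (d :: s1), f, s2; rewrite sE.
Qed.

Lemma walk_path d s : walk (otgt d) s -> path no_backtrack d s ->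
  path (fun f f' => (otgt f == osrc f') && (f' != obar f)) d s.
Proof.
elim: s d => //= d' s IH d /and3P[/eqP dd' _ ws] /andP[nb ps].
by rewrite dd' eqxx [_ != _]nb IH.
Qed.

Hypothesis acycT : acyclic T.

Lemma walk_all v s : walk v s -> all (fun d => d.1 \in T) s.
Proof. by elim: s v => //= d s IH v /and3P[_ -> /IH]. Qed.

(* A first return to the starting vertex would close up a circuit. *)
Lemma walk_uniq v s : walk v s -> sorted no_backtrack s ->
  uniq (v :: [seq otgt d | d <- s]).
Proof.
elim: s v => //= d s IH v /and3P[/eqP dv dT ws] ps.
have {IH} us := IH _ ws (path_sorted ps).
apply/andP; split; last exact: us.
apply/negP => vin.
pose i := index v [seq otgt f | f <- d :: s].
have vi : v \in [seq otgt f | f <- d :: s] by [].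
pose s1 := take i s.
have s1E : d :: s1 = take i.+1 (d :: s) by [].
have wend1 : wend v (d :: s1) = v.
  rewrite /wend s1E map_take (take_nth v) ?index_mem// last_rcons.
  exact: nth_index.
have ws1 : walk (otgt d) s1.
  by move: ws; rewrite -{1}(cat_take_drop i s) walk_cat => /andP[].
have ps1 : path no_backtrack d s1.
  by move: ps; rewrite -{1}(cat_take_drop i s) cat_path => /andP[].
have us1 : uniq [seq otgt f | f <- d :: s1].
  by rewrite s1E map_take take_uniq.
have := acycT (s := d :: s1); rewrite /= dT (walk_all ws1) => /(_ isT) /negP; apply.
rewrite /is_circuit [uniq _]us1 andbT /= rcons_path walk_path//=.
have -> : otgt (last d s1) = v by rewrite -[RHS]wend1 /wend /= last_map.
(* It remains to exclude backtracking where the circuit closes: if its last edge were the reverse of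
   [d], the end of [d] would occur twice. *)
rewrite dv eqxx /=; apply/eqP => dE.
case/lastP: s1 ws1 ps1 us1 wend1 dE {s1E} => [|s2 e] ws1 ps1 us1 wend1 /=.
  by move/eqP; rewrite (negbTE (obar_neq d)).
rewrite last_rcons => dE.
have ed : e = obar d by rewrite dE obarK.
move: ws1; rewrite -cats1 walk_cat => /andP[_] /= /and3P[/eqP se _ _].
rewrite ed osrc_obar in se.
case: s2 ps1 us1 se wend1 => [|f s2] ps1 us1 se wend1.
  by move: ps1; rewrite /= andbT /no_backtrack ed eqxx.
move: us1; rewrite /= => /andP[/negP H _]; apply: H.
have : wend (otgt d) (f :: s2) \in [seq otgt g | g <- f :: s2].
  by rewrite /wend /= mem_last.
rewrite -se => tdin.
by rewrite -[_ :: _]/[seq otgt g | g <- rcons (f :: s2) e] map_rcons mem_rcons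
  in_cons tdin orbT.
Qed.

Variables (H : groupType) (lab : oedge Y -> H).
Hypothesis lab_obar : forall d, lab (obar d) = (lab d)^-1%g.

Definition hol s : H := foldr (fun d h => lab d * h)%g 1%g s.

Lemma hol_cat s1 s2 : hol (s1 ++ s2) = (hol s1 * hol s2)%g.
Proof. by elim: s1 => [|d s1 IH] /=; rewrite ?mul1g// IH mulgA. Qed.

Lemma hol_rev s : hol (rev [seq obar d | d <- s]) = (hol s)^-1%g.
Proof.
elim: s => [|d s IH] /=; first by rewrite invg1.
by rewrite rev_cons -cats1 hol_cat IH /= mulg1 lab_obar invgM.
Qed.

(** A nonempty closed walk in a forest backtracks somewhere, and deleting the backtrack preserves
    the holonomy. *)
Lemma hol_closed v s : walk v s -> wend v s = v -> hol s = 1%g.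
Proof.
have [m] := ubnP (size s); elim: m s => // m IH s; rewrite ltnS => sm ws we.
have [ss|/backtrackP[s1 [d [s2 sE]]]] := boolP (sorted no_backtrack s).
  have /= /andP[/negP nin _] := walk_uniq ws ss.
  case: s {sm IH ss} ws we nin => // d s _ we nin; case: nin.
  by rewrite -{1}we /wend /= mem_last.
have bt : hol [:: d, obar d & s2] = hol s2 by rewrite /= lab_obar mulgA mulgV mul1g.
rewrite sE hol_cat bt -hol_cat; apply: IH.
- by move: sm; rewrite sE !size_cat /=; lia.
- move: ws; rewrite sE !walk_cat => /andP[-> /=].
  by rewrite osrc_obar otgt_obar => /and5P[/eqP -> _ _ _].
- move: we ws; rewrite sE !wend_cat walk_cat => we /andP[_ /= /andP[/eqP <- _]].
  by rewrite -[RHS]we /wend /= otgt_obar.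
Qed.

Hypothesis connT : connected_by T.
Variable v0 : vert Y.

Lemma walk_exists v : exists s, walk v0 s /\ wend v0 s = v.
Proof.
have /connectP[p] := connT v0 v.
elim: p (v0) => [|x p IH] u /=; first by move=> _ ->; exists [::].
move=> /andP[/existsP[d /and3P[dT /eqP sd /eqP td]] pp] vE.
have [s [ws we]] := IH x pp vE; exists (d :: s).
by rewrite /= sd eqxx dT td ws -we /wend /= td.
Qed.

(** The potential of a vertex is the holonomy of a walk in [T] from [v0] to it. *)
Lemma holonomy_potential : exists gam : vert Y -> H,
  forall d, d.1 \in T -> (gam (osrc d) * lab d = gam (otgt d))%g.
Proof.
have /choice[p pP] := walk_exists.
exists (fun v => hol (p v)) => d dT.
have [w1 e1] := pP (osrc d); have [w2 e2] := pP (otgt d).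
have [w3 e3] := walk_rev w2.
rewrite e2 in w3 e3.
have := @hol_closed v0 (p (osrc d) ++ d :: rev [seq obar f | f <- p (otgt d)]).
rewrite walk_cat w1 e1 /= eqxx dT w3 wend_cat e1 => /(_ isT).
rewrite hol_cat /= hol_rev mulgA => E0; apply: (mulIg (hol (p (otgt d)))^-1%g).
by rewrite mulgV; apply: E0.
Qed.

End Holonomy.

(** * Embedding the fundamental group *)

Section Embedding.
Variables (Y : graph_of_groups) (T : {set edge Y}).
Hypothesis treeT : spanning_tree T.
Variables (x : forall v : vert Y, vgroup v) (ce : forall e : edge Y, egroup e).
Hypothesis x_bij : forall v, bijective (expgz (x v)).
Hypothesis ce_bij : forall e, bijective (expgz (ce e)).
Variable (N : oedge Y -> int).
Hypothesis oinclE : forall e, oincl e (ce e) = expgz (x (gorig e)) (N (e, false)).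
Hypothesis tinclE : forall e, tincl e (ce e) = expgz (x (gterm e)) (N (e, true)).

(** An index 0 would make the edge inclusion kill the generator of the infinite cyclic edge
    group. *)
Lemma index_neq0 d : N d != 0.
Proof.
have ce1 e : ce e <> 1%g.
  move=> c1; have [f fK _] := ce_bij e.
  have := fK 1; have := fK 0; rewrite expgz0 expgz1 c1 => -> //.
case: d => e []; apply/eqP => N0.
  have := tinclE e; rewrite N0 expgz0 -(gmulf1g (tincl e)).
  by move=> /(@tincl_inj _ e); exact: ce1.
have := oinclE e; rewrite N0 expgz0 -(gmulf1g (oincl e)).
by move=> /(@oincl_inj _ e); exact: ce1.
Qed.

Let vlog (v : vert Y) (g : vgroup v) : int :=
  xget 0 [set k | expgz (x v) k = g].

Lemma vlogK v (g : vgroup v) : expgz (x v) (vlog g) = g.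
Proof.
have [f _ fK] := x_bij v.
by apply: (@xgetPex _ 0 [set k | expgz (x v) k = g]); exists (f g); exact: fK.
Qed.

Lemma vlog_expgz v k : vlog (expgz (x v) k) = k.
Proof. by apply: (bij_inj (x_bij v)); rewrite vlogK. Qed.

Lemma vlogM v (g h : vgroup v) : vlog (g * h)%g = vlog g + vlog h.
Proof. by apply: (bij_inj (x_bij v)); rewrite expgzD !vlogK. Qed.

Let P : groupType := pi1 T.
Let vg (v : vert Y) (g : vgroup v) : P := pgen (pi1_rel T) (vgen g).
Let al (v : vert Y) : P := vg (x v).
Let tau (d : oedge Y) : P :=
  if d.2 then (pgen (pi1_rel T) (egen d.1))^-1%g
  else pgen (pi1_rel T) (egen d.1).

Lemma vgM v : {morph @vg v : g h / (g * h)%g}.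
Proof.
move=> g h; have /(pclassP (pi1_rel T)) := word_eq_rel (pi1_rel_vertex T g h).
by rewrite pclass_cat => ->.
Qed.

Lemma vg_expgz v k : vg (expgz (x v) k) = expgz (al v) k.
Proof.
pose f : {multiplicative vgroup v -> P} :=
  HB.pack (@vg v) (isMultiplicative.Build _ _ (@vg v) (@vgM v)).
exact: (gmulf_expgz f).
Qed.

Lemma tau_obar d : tau (ebar d) = (tau d)^-1%g.
Proof. by case: d => e [] //; rewrite /tau /= invgK. Qed.

Lemma tau_rel d :
  (tau d * expgz (al (otgt d)) (N (ebar d)) =
   expgz (al (osrc d)) (N d) * tau d)%g.
Proof.
have H0 e : (tau (e, false) * expgz (al (gterm e)) (N (e, true)) =
    expgz (al (gorig e)) (N (e, false)) * tau (e, false))%g.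
  have /(pclassP (pi1_rel T)) := word_eq_rel (pi1_rel_edge T (ce e)).
  rewrite !pclass_cat pclass_geninv -!/(vg _) tinclE oinclE => H0.
  rewrite -!vg_expgz -[vg (expgz (x (gorig e)) _)]H0.
  by rewrite !mulgA mulgVK.
case: d => e []; last exact: H0.
rewrite /ebar /= -[tau (e, true)]/(tau (e, false))^-1%g.
apply: (mulgI (tau (e, false))); rewrite mulVKg mulgA.
by rewrite -[otgt (e, true)]/(gorig e) -[osrc (e, true)]/(gterm e) H0 mulgK.
Qed.

Lemma tau_tree d : d.1 \in T -> tau d = 1%g.
Proof.
case: d => e b /= eT.
have e1 : pgen (pi1_rel T) (egen e) = 1%g.
  by apply/(pclassP (pi1_rel T)); apply: word_eq_rel; exact: pi1_rel_tree.
by case: b; rewrite /tau /= e1 ?invg1.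
Qed.

Local Notation B := (rose (E := edge Y) N).

(** All vertices are identified, and conjugation by the potential [gam] makes the edges of the tree
    trivial as the relations require. The element [g] is kept to record a nontrivial elliptic
    image. *)
Lemma pi1_embedding : exists (phi : {multiplicative P -> B}) (p : B) (g : P),
  injective phi /\ phi g = (p * expgz (ra (E := edge Y) N) 1 * p^-1)%g.
Proof.
have [/card_gt0P[v0 _] connT acycT] := treeT.
have [gam gamP] := @holonomy_potential Y T acycT B (@rs _ N) (@rs_ebar _ N) connT v0.
pose F (z : pi1_gen Y) : B := match z with
  | inl vz => (gam (tag vz) * expgz (ra N) (vlog (tagged vz)) * (gam (tag vz))^-1)%g
  | inr e => (gam (gorig e) * rs N (e, false) * (gam (gterm e))^-1)%g
  end.
have [phi phiE] : exists phi : {multiplicative P -> B},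
    forall z, phi (pgen (pi1_rel T) z) = F z.
  apply: presented_lift => u1 u2 [v g h|e c|e eT] k.
  - rewrite /= !mulgA mulgVK vlogM expgzD !mulgA.
    by [].
  - rewrite /= !invgM !invgK !mulgA.
    have [f _ fK] := ce_bij e; rewrite -(fK c) !gmulf_expgz tinclE oinclE.
    rewrite -!expgzM !vlog_expgz !mulgVK.
    have := @rs_rel _ N (e, false); rewrite /ebar /= => re.
    rewrite (expgzM _ (N (e, true))) (expgzM _ (N (e, false))).
    have -> : (gam (gorig e) * rs N (e, false) *
      expgz (expgz (ra N) (N (e, true))) (f c) = gam (gorig e) *
      expgz (expgz (ra N) (N (e, false))) (f c) * rs N (e, false))%g.
      rewrite -!mulgA; congr (_ * _)%g.
      apply: (mulIg (rs N (e, false))^-1%g); rewrite -expgz_conj re mulgK.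
      by rewrite mulgK.
    by rewrite mulgK.
  - by rewrite /= (gamP (e, false))//= mulgV mul1g.
have phi_al v k : phi (expgz (al v) k) = (gam v * expgz (ra N) k * (gam v)^-1)%g.
  by rewrite -vg_expgz phiE /= vlog_expgz.
have phi_tau d : phi (tau d) = (gam (osrc d) * rs N d * (gam (otgt d))^-1)%g.
  case: d => e []; rewrite /tau /= ?gmulfVg phiE//=.
  by rewrite !invgM invgK mulgA.
pose nfg v g : nform (edge Y) := nf ((gam v)^-1 * phi g * gam v0)%g.
(* Injectivity: the normal form of the image is a path in the graph from [v] to [v0], and its
   evaluation in [P] recovers [g]. *)
pose J v g : Prop := valid (@osrc Y) (@otgt Y) v v0 (nfg v g) /\
  ev (@otgt Y) al tau v (nfg v g) = g.
have J_al v k g : J v g -> J v (expgz (al v) k * g)%g.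
  move=> [val evE].
  have nE : nfg v (expgz (al v) k * g)%g = addz N k (nfg v g).
    rewrite -act_ra ?nf_reduced//; last exact: index_neq0.
    rewrite /nfg -nfM; last exact: index_neq0.
    by congr nf; rewrite gmulfM phi_al !mulgA mulVg mul1g.
  rewrite /J nE; split; first exact: valid_addz.
  by rewrite (ev_addz tau_rel k val) evE.
have J_tau d g : J (otgt d) g -> J (osrc d) (tau d * g)%g.
  move=> [val evE].
  have nE : nfg (osrc d) (tau d * g)%g = cross d (nfg (otgt d) g).
    rewrite -(@act_rs _ N) ?nf_reduced//; last exact: index_neq0.
    rewrite /nfg -nfM; last exact: index_neq0.
    by congr nf; rewrite gmulfM phi_tau !mulgA mulVg mul1g.
  rewrite /J nE; split; first exact: (valid_cross (@osrc_obar Y)).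
  by rewrite (ev_cross (@osrc_obar Y) al tau_obar val) evE.
(* Edges of [T] are trivial in [P], so the start vertex can be moved freely along the tree. *)
have J_tree v w g : J w g -> J v g.
  have /connectP[q] := connT v w.
  elim: q v => [|z q IH] v /=; first by move=> _ ->.
  move=> /andP[/existsP[d /and3P[dT /eqP <- /eqP td]] zq] wE Jw.
  by rewrite -[g]mul1g -(tau_tree dT); apply: J_tau; rewrite td; exact: IH.
have J_all g : J v0 g.
  elim/presented_ind: g => [|z g Jg|z g Jg].
  - rewrite /J /nfg gmulf1g mulg1 mulVg nf1; last exact: index_neq0.
    by rewrite /= expg0.
  - case: z => [[v z]|e].
      have -> : pgen (pi1_rel T) (inl (existT _ v z)) = expgz (al v) (vlog z).
        by rewrite -vg_expgz vlogK.
      by apply: (J_tree _ v); apply: J_al; exact: J_tree Jg.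
    apply: (J_tree _ (gorig e)); apply: (J_tau (e, false)); exact: J_tree Jg.
  - case: z => [[v z]|e].
      have -> : (pgen (pi1_rel T) (inl (existT _ v z)))^-1%g =
          expgz (al v) (- vlog z).
        by rewrite expgzN -vg_expgz vlogK.
      by apply: (J_tree _ v); apply: J_al; exact: J_tree Jg.
    apply: (J_tree _ (gterm e)); apply: (J_tau (e, true)); exact: J_tree Jg.
exists phi, (gam v0), (expgz (al v0) 1); split; last exact: phi_al.
move=> g h gh; apply/eqP; rewrite -divg_eq1; apply/eqP.
have [_ <-] := J_all (g / h)%g.
rewrite /nfg gmulfM gmulfVg gh mulgV mulg1 mulVg nf1; last exact: index_neq0.
by rewrite /= expg0.
Qed.

End Embedding.

Theorem proposition9p1 (R : realType) (G : groupType)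
    (G_nontrivial : nontrivial G) (G_gbs : generalised_BS G)
    (G_not_simple : ~ Cstar_simple R G) :
  (exists n : int, n != 0 /\ isomorphic G (BS1 n)) \/ unimodular G.
Proof.
have [_ [Y [T [treeT cycV cycE [f f_bij]]]]] := G_gbs.
pose x v := sval (cid (cycV v)); pose ce e := sval (cid (cycE e)).
have x_bij v : bijective (expgz (x v)) := svalP (cid (cycV v)).
have ce_bij e : bijective (expgz (ce e)) := svalP (cid (cycE e)).
have xlog v (g : vgroup v) : exists k, g = expgz (x v) k.
  by have [h _ hK] := x_bij v; exists (h g).
have /choice[No NoE] : forall e, exists k, oincl e (ce e) = expgz (x (gorig e)) k.
  by move=> e; exact: xlog.
have /choice[Nt NtE] : forall e, exists k, tincl e (ce e) = expgz (x (gterm e)) k.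
  by move=> e; exact: xlog.
pose N (d : oedge Y) := if d.2 then Nt d.1 else No d.1.
have [phi [p [g [phi_inj gE]]]] :=
  @pi1_embedding Y T treeT x ce x_bij ce_bij N NoE NtE.
have N0 := @index_neq0 Y x ce ce_bij N NoE NtE.
have phifM : {morph (phi \o f) : y z / (y * z)%g}.
  by move=> y z; rewrite /= !gmulfM.
pose psi : {multiplicative G -> rose (E := edge Y) N} :=
  HB.pack (phi \o f) (isMultiplicative.Build _ _ (phi \o f) phifM).
have psi_inj : injective psi := inj_comp phi_inj (bij_inj f_bij).
have [f' _ f'K] := f_bij.
(* The preimage of [g] is the elliptic element required, with exponent 1 and conjugator [p]. *)
apply: (@rose_subgroup _ N N0 G psi psi_inj R (f' g) 1 p) => //.
by rewrite /= f'K.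
Qed.
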